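(* Let $G$ be the augmented digraph described in the context, with weight function $w\colon A_G\to\mathbb{R}$ and with node set partitioned into color classes $V_1,\dots,V_k$, and let $\mathcal{M}_V$ be the corresponding rainbow matroid on $V_G$. Then the primal–dual contraction–restoration algorithm described in the context is correct: for every execution, it constructs a matroid branching $B$ in $G$ with respect to $\mathcal{M}_V$ that covers all colors $1,\dots,k$ and has the minimum weight $w(B)=\sum_{a\in B}w(a)$ among all matroid branchings in $G$ with respect to $\mathcal{M}_V$ that cover all colors.
   Context: A digraph has a finite node set and a finite arc set; each arc has a tail and a head, and parallel arcs may arise. For a set $X$ of nodes, $\delta^{\rm in}(X)$ (resp. $\delta^{\rm out}(X)$) is the set of arcs entering (resp. leaving) $X$, and $\gamma(X)$ is the set of arcs with both endpoints in $X$. A branching is a set $B$ of arcs such that the underlying undirected graph spanned by $B$ is acyclic and each node is entered (covered) by at most one arc of $B$; $C(B)$ is the set of nodes entered by an arc of $B$. Rainbow matroid and colors. If the nodes are partitioned into nonempty color classes $V_1,\dots,V_k$, the rainbow matroid $\mathcal{M}_V$ has as independent sets exactly the sets of nodes containing at most one node from each $V_j$. A matroid branching (w.r.t. $\mathcal{M}_V$) is a branching $B$ such that $C(B)$ is independent, i.e. $C(B)$ has at most one node of each color. It covers color $j$ if $C(B)\cap V_j\ne\emptyset$. Augmented digraph. One starts with a digraph $G_0$ having a nonempty node set partitioned into $k$ nonempty color classes and with arc weights $w\colon A_{G_0}\to\mathbb{R}$. The digraph $G$ is obtained by adding an auxiliary node $s$ (assigned an arbitrary one of the $k$ existing colors)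 and auxiliary arcs $(s,v)$ for all $v\in V_{G_0}$, each of the same weight $M$, a large positive number ($M>0$ and $M>w(a)$ for all $a\in A_{G_0}$). $V_1,\dots,V_k$ denotes the resulting partition of $V_G$. Reduced weights. For $\pi\colon\{1,\dots,k\}\to\mathbb{R}$ and $\xi\colon 2^{V_G}\to\mathbb{R}_+$ put $$w' := w-\sum_{j=1}^k \pi(j)\sum_{v\in V_j}\chi^{\delta^{\rm in}(v)}+\sum_{X\subseteq V_G}\xi(X)\chi^{\gamma(X)},$$ where $\chi^A$ is the indicator function of $A \subseteq A_G$. Contraction. For nonempty $Z\subseteq V_H$, $H/Z$ is obtained from the digraph $H$ by replacing the nodes in $Z$ by one new (composite) node $\overline Z$, removing the arcs of $\gamma(Z)$, and redirecting to $\overline Z$ the heads of arcs in $\delta^{\rm in}(Z)$ and the tails of arcs in $\delta^{\rm out}(Z)$; arcs of $H/Z$ are identified with arcs of $H$ not in $\gamma(Z)$. If the nodes of $H$ are colored and the nodes of $Z$ have distinct colors, the coloring of $H/Z$ is obtained by uniting the colors of all nodes of $Z$ into one color, which is also the color of $\overline Z$; all other colors are unchanged. Contraction phase. Start with $G^0:=G$ with its coloring, $B^0:=\emptyset$, $\xi^0:=0$, and any $\pi^0$ such that $w'\ge 0$. At each step $i$ the current digraph $G^i$ arises from $G$ by contracting a number of disjoint inclusion-wise maximal contracted sets $Q_1,\dots,Q_s\subseteq V_G$ (initially $s=0$), each current color is a union of original colors, and $B^i$ is a branching in $G^i$ covering at most one node of each current color. If $B^i$ covers all current colors having an incoming arc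 in $G^i$, stop and put $N:=i$. Otherwise choose a current color $c$ not covered by $B^i$ and having at least one incoming arc in $G^i$. – Dual step: if $w'(a)>0$ for all arcs $a$ of $G^i$ entering nodes of color $c$, increase $\pi(j)$ by $\epsilon$ for all original colors $j$ united in $c$ and increase $\xi(Q_j)$ by $\epsilon$ for all $Q_j$ whose composite node has color $c$, leaving all other values unchanged; this decreases by $\epsilon$ the reduced weights of the arcs of $G^i$ entering nodes of color $c$ and preserves all other reduced weights. Here $\epsilon$ is the largest positive number for which the new reduced weights are nonnegative. Put $G^{i+1}:=G^i$, $B^{i+1}:=B^i$. – Primal step: otherwise choose an arc $a$ of $G^i$ entering a node of color $c$ with $w'(a)=0$. If $B^i\cup\{a\}$ contains no directed cycle, put $G^{i+1}:=G^i$, $B^{i+1}:=B^i\cup\{a\}$. Otherwise let $K$ be the cycle in $B^i\cup\{a\}$ and $Z$ its node set; put $G^{i+1}:=G^i/Z$ (with updated colors) and $B^{i+1}:=B^i\setminus\gamma(Z)$. The values of $\pi,\xi$ do not change. Restoration phase. Put $\widehat B^N:=B^N$. For $i=N,\dots,1$: if no contraction occurred in passing from $G^{i-1}$ to $G^i$, put $\widehat B^{i-1}:=\widehat B^i$. If a cycle $K$ with node set $Z$ in $G^{i-1}$ was contracted to $\overline Z$ in $G^i$, then: if no arc of $\widehat B^i$ enters $\overline Z$, choose $u\in Z$ such that $C(\widehat B^i)\cup(Z\setminus\{u\})$ has at most one node of each color of $G^{i-1}$, and let $a$ be the arc of $K$ entering $u$; if an arc $b\in\widehat B^i$ enters $\overline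 Z$, let $a$ be the arc of $K$ with the same head in $G^{i-1}$ as $b$. In both cases put $\widehat B^{i-1}:=\widehat B^i\cup(A_K\setminus\{a\})$. The output is $B:=\widehat B^0$. *)

(* Defs.v *)
From mathcomp Require Import all_boot all_order all_algebra.

Set Implicit Arguments.
Unset Strict Implicit.
Unset Printing Implicit Defensive.

Import Order.TTheory GRing.Theory Num.Theory.
Local Open Scope ring_scope.

(* Node and arc sets are subsets of ambient finite types, so that contraction
   does not change the carrier types and arcs of H/Z are arcs of H. The values
   of tail and head outside of the arc set are irrelevant. *)
Record digraph (N A : finType) := Digraph {
  nodes : {set N};
  arcs : {set A};
  tail : A -> N;
  head : A -> N }.

Section Digraphs.
Variables (N A C : finType) (H : digraph N A).

Definition din (X : {set N}) : {set A} :=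
  [set a in arcs H | (tail H a \notin X) && (head H a \in X)].

Definition dout (X : {set N}) : {set A} :=
  [set a in arcs H | (tail H a \in X) && (head H a \notin X)].

Definition gamma (X : {set N}) : {set A} :=
  [set a in arcs H | (tail H a \in X) && (head H a \in X)].

(* C(B) *)
Definition covered (B : {set A}) : {set N} :=
  [set v in nodes H | B :&: din [set v] != set0].

(* A traversal (a, b) of the arc a goes forward if b, backward otherwise. *)
Definition trav_src (x : A * bool) : N :=
  if x.2 then tail H x.1 else head H x.1.
Definition trav_dst (x : A * bool) : N :=
  if x.2 then head H x.1 else tail H x.1.

(* A cycle of the underlying undirected multigraph, with distinct nodes and
   distinct arcs; a loop is a cycle of length 1, and two parallel or opposite
   arcs form a cycle of length 2. *)
Definition undirected_cycle (p : seq (A * bool)) : Prop :=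
  [/\ p != [::],
      {subset [seq x.1 | x <- p] <= arcs H},
      cycle [rel x y | trav_dst x == trav_src y] p,
      uniq [seq trav_src x | x <- p] &
      uniq [seq x.1 | x <- p] ].

Definition acyclic (B : {set A}) : Prop :=
  forall p, undirected_cycle p -> ~ {subset [seq x.1 | x <- p] <= B}.

Definition branching (B : {set A}) : Prop :=
  [/\ B \subset arcs H,
      acyclic B &
      forall v, v \in nodes H -> (#|B :&: din [set v]| <= 1)%N].

(* K is the arc set of a directed cycle with distinct nodes. *)
Definition directed_cycle (K : {set A}) : Prop :=
  exists p : seq A,
    [/\ p != [::],
        {subset p <= arcs H},
        cycle [rel a b | head H a == tail H b] p,
        uniq [seq head H a | a <- p] &
        K = [set a in p] ].

Definition cycle_nodes (K : {set A}) : {set N} := [set head H a | a in K].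

Variable color : N -> C.

Definition color_class (c : C) : {set N} := [set v in nodes H | color v == c].

(* Independence in the rainbow matroid of the coloring. *)
Definition rainbow (I : {set N}) : Prop :=
  I \subset nodes H /\ forall c, (#|I :&: color_class c| <= 1)%N.

Definition matroid_branching (B : {set A}) : Prop :=
  branching B /\ rainbow (covered B).

Definition covers (B : {set A}) (c : C) : Prop :=
  covered B :&: color_class c != set0.

Definition entering_color (c : C) : {set A} :=
  \bigcup_(v in color_class c) din [set v].

End Digraphs.

Section Augmentation.
Variables (R : realFieldType) (C V0 A0 : finType).
Variables (tail0 head0 : A0 -> V0) (color0 : V0 -> C) (w0 : A0 -> R).

(* The auxiliary node s is None; inr v is the auxiliary arc (s, v). *)
Definition augmented : digraph (option V0) (A0 + V0)%type :=
  Digraph [set: option V0] [set: A0 + V0]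
    (fun a => match a with inl e => Some (tail0 e) | inr _ => None end)
    (fun a => match a with inl e => Some (head0 e) | inr v => Some v end).

Definition augmented_color (cs : C) (v : option V0) : C :=
  if v is Some u then color0 u else cs.

Definition augmented_weight (M : R) (a : A0 + V0) : R :=
  if a is inl e then w0 e else M.

End Augmentation.

Section Algorithm.
Variables (R : realFieldType) (k : nat) (V A : finType).
Variables (G : digraph V A) (color : V -> 'I_k) (w : A -> R).

Definition reduced_weight (pi : 'I_k -> R) (xi : {set V} -> R) (a : A) : R :=
  w a
  - \sum_(j < k) pi j *
      \sum_(v in color_class G color j) (a \in din G [set v])%:R
  + \sum_(X : {set V} | X \subset nodes G) xi X * (a \in gamma G X)%:R.

(* A node of a current digraph G^i is named by the set of nodes of G that it
   represents: [set v] stands for the uncontracted node v, and a composite node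
   is named by the contracted set Q_j itself. A current color is the set of
   original colors united in it. *)
Definition cdigraph := digraph {set V} A.
Definition ccolor := {set 'I_k}.

Definition uncontracted : cdigraph :=
  Digraph [set [set v] | v in nodes G] (arcs G)
    (fun a => [set tail G a]) (fun a => [set head G a]).

(* On a singleton [set v] this is [set color v]. *)
Definition uncontracted_color (X : {set V}) : ccolor := [set color v | v in X].

(* The composite node of Z is cover Z, the union of the members of Z. *)
Definition contract (H : cdigraph) (Z : {set {set V}}) : cdigraph :=
  Digraph (cover Z |: (nodes H :\: Z))
    (arcs H :\: gamma H Z)
    (fun a => if a \in dout H Z then cover Z else tail H a)
    (fun a => if a \in din H Z then cover Z else head H a).

Definition contract_color (f : {set V} -> ccolor) (Z : {set {set V}})
    (X : {set V}) : ccolor :=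
  if (X == cover Z) || (f X \in [set f Y | Y in Z])
  then \bigcup_(Y in Z) f Y else f X.

Record state := State {
  st_graph : cdigraph;                  (* G^i *)
  st_color : {set V} -> ccolor;
  st_contracted : {set {set V}};        (* the maximal contracted sets Q_j *)
  st_branching : {set A};               (* B^i *)
  st_pi : 'I_k -> R;
  st_xi : {set V} -> R }.

Definition st_weight (S : state) : A -> R :=
  reduced_weight (st_pi S) (st_xi S).

Definition initial_state (pi0 : 'I_k -> R) : state :=
  State uncontracted uncontracted_color set0 set0 pi0 (fun=> 0).

Definition st_entering (S : state) (c : ccolor) : {set A} :=
  entering_color (st_graph S) (st_color S) c.

Definition st_covers (S : state) (c : ccolor) : Prop :=
  covers (st_graph S) (st_color S) (st_branching S) c.

Definition stopping (S : state) : Prop :=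
  forall c, st_entering S c != set0 -> st_covers S c.

Definition selectable (S : state) (c : ccolor) : Prop :=
  ~ st_covers S c /\ st_entering S c != set0.

Definition dual_update (S : state) (c : ccolor) (eps : R) : state :=
  State (st_graph S) (st_color S) (st_contracted S) (st_branching S)
    (fun j => if j \in c then st_pi S j + eps else st_pi S j)
    (fun X => if (X \in st_contracted S) && (st_color S X == c)
              then st_xi S X + eps else st_xi S X).

Definition feasible_eps (S : state) (c : ccolor) (eps : R) : Prop :=
  0 < eps /\ forall a, a \in arcs G -> 0 <= st_weight (dual_update S c eps) a.

Definition add_update (S : state) (a : A) : state :=
  State (st_graph S) (st_color S) (st_contracted S) (a |: st_branching S)
    (st_pi S) (st_xi S).

Definition contract_update (S : state) (Z : {set {set V}}) : state :=
  State (contract (st_graph S) Z) (contract_color (st_color S) Z)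
    (cover Z |: (st_contracted S :\: Z))
    (st_branching S :\: gamma (st_graph S) Z)
    (st_pi S) (st_xi S).

(* The label of a step is Some K if the step contracts the cycle with arc set K,
   and None if no contraction occurs. *)
Inductive contraction_step (S : state) : option {set A} -> state -> Prop :=
| DualStep c eps of
    selectable S c &
    (forall a, a \in st_entering S c -> 0 < st_weight S a) &
    feasible_eps S c eps &
    (forall eps', feasible_eps S c eps' -> eps' <= eps) :
    contraction_step S None (dual_update S c eps)
| PrimalAdd c a of
    selectable S c &
    a \in st_entering S c &
    st_weight S a = 0 &
    (forall K, directed_cycle (st_graph S) K ->
       ~~ (K \subset a |: st_branching S)) :
    contraction_step S None (add_update S a)
| PrimalContract c a K of
    selectable S c &
    a \in st_entering S c &
    st_weight S a = 0 &
    directed_cycle (st_graph S) K &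
    K \subset a |: st_branching S :
    contraction_step S (Some K)
      (contract_update S (cycle_nodes (st_graph S) K)).

(* From \hat B^i to \hat B^{i-1}; S is the state at i-1 and the label is that of
   the step from i-1 to i. *)
Inductive restoration_step (S : state) (B : {set A}) :
    option {set A} -> {set A} -> Prop :=
| RestoreNone : restoration_step S B None B
| RestoreUncovered K u a (H := st_graph S) (Z := cycle_nodes H K)
    (H' := contract H Z) of
    B :&: din H' [set cover Z] = set0 &
    u \in Z &
    rainbow H (st_color S) (covered H' B :|: (Z :\ u)) &
    a \in K &
    head H a = u :
    restoration_step S B (Some K) (B :|: (K :\ a))
| RestoreCovered K b a (H := st_graph S) (Z := cycle_nodes H K)
    (H' := contract H Z) of
    b \in B :&: din H' [set cover Z] &
    a \in K &
    head H a = head H b :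
    restoration_step S B (Some K) (B :|: (K :\ a)).

(* The states already traversed, most recent first, each with the label of the
   step that left it. *)
Definition history := seq (state * option {set A}).

Inductive config :=
| Contracting of history & state
| Restoring of history & {set A}.

Definition output (B : {set A}) : config := Restoring [::] B.

Inductive initial : config -> Prop :=
| Initial pi0 of
    (forall a, a \in arcs G -> 0 <= reduced_weight pi0 (fun=> 0) a) :
    initial (Contracting [::] (initial_state pi0)).

Inductive step : config -> config -> Prop :=
| StepContract h S l S' of contraction_step S l S' :
    step (Contracting h S) (Contracting ((S, l) :: h) S')
| StepStop h S of stopping S :
    step (Contracting h S) (Restoring h (st_branching S))
| StepRestore S l h B B' of restoration_step S B l B' :
    step (Restoring ((S, l) :: h) B) (Restoring h B').

Inductive reachable : config -> Prop :=
| ReachInitial c of initial c : reachable c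
| ReachStep c c' of reachable c & step c c' : reachable c'.

Definition covering_matroid_branching (B : {set A}) : Prop :=
  matroid_branching G color B /\ forall j : 'I_k, covers G color B j.

Definition min_covering_matroid_branching (B : {set A}) : Prop :=
  covering_matroid_branching B /\
  forall B', covering_matroid_branching B' ->
    \sum_(a in B) w a <= \sum_(a in B') w a.

(* Every execution terminates, never gets stuck before reaching an output, and
   outputs a minimum-weight matroid branching covering all colors. *)
Definition algorithm_correct : Prop :=
  [/\ ~ (exists f : nat -> config,
           initial (f 0%N) /\ forall i, step (f i) (f i.+1)),
      forall c, reachable c ->
        (exists B, c = output B) \/ (exists c', step c c') &
      forall B, reachable (output B) -> min_covering_matroid_branching B].

End Algorithm.

(* Main.v *)
(* A rainbow branching covering all colors has weight at least
   \sum_j pi j - \sum_X xi X (|X| - 1) whenever the reduced weights and xi are nonnegative,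
   with equality iff it uses only tight arcs and spans every X with xi X > 0. The contraction
   phase keeps all reduced weights nonnegative, and those of the current branching and of the
   contracted cycles zero: a dual step for the color c changes, among non-loop arcs, only
   those that enter c in the current graph. Undoing the contraction of a cycle K adds all its
   arcs but one, so that every contracted set ends up spanned; the omitted arc is the one whose
   head has the color by which the merged color of K is covered. Every color always has an
   incoming arc, because of the root s, so the final branching covers all colors. *)

Require Import Defs.
From mathcomp Require Import all_boot all_order all_algebra.
From mathcomp Require Import zify lra.
From Stdlib Require Import Classical.
(* Makes [head] denote the head of an arc again, rather than that of a sequence. *)
Import Defs.
Import Order.TTheory GRing.Theory Num.Theory.
Local Open Scope ring_scope.

Set Implicit Arguments.
Unset Strict Implicit.
Unset Printing Implicit Defensive.

(** A current color may contain several nodes, so the merged color of a contracted cycle can be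
    covered at a node other than the composite one. What survives the restoration is therefore a
    statement about colors: at every level the branching has exactly one arc for each color of a
    node, and the arc of the merged color plays the part of an arc that enters the composite node.
    Loops need care: [gamma] counts a loop inside a contracted set, but [din] of a single node
    contains no loop. So [pi] cannot lower the reduced weight of a loop, while a dual step can raise
    it. Termination cannot be read off the real dual values. It rests on the maximality of [eps],
    which makes a new arc tight, while a dual step leaves every tight non-loop arc tight. *)

Section Digraphs.
Variables (N A C : finType) (H : digraph N A) (f : N -> C).
Implicit Types (B K : {set A}) (X Y : {set N}) (e : A).

(** * Arc sets with distinct head colors and a source in every node set *)

Definition proper_ends :=
  forall e, e \in arcs H -> tail H e \in nodes H /\ head H e \in nodes H.

(* For in-degree at most 1 this is equivalent to acyclicity, and unlike acyclicity it
   passes easily through contraction and restoration. *)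
Definition sourced B := forall X, X \subset nodes H -> X != set0 ->
  exists2 v, v \in X & forall e, e \in B -> head H e = v -> tail H e \notin X.

Definition hcolor e : C := f (head H e).

(* Since each non-loop arc enters one node, injectivity of the head color says at once
   that in-degrees are at most 1 and that the covered nodes have distinct colors. *)
Record rainbow_forest B : Prop := RainbowForest {
  rf_arcs : B \subset arcs H;
  rf_inj : {in B &, injective hcolor};
  rf_sourced : sourced B }.

Lemma din1E v e : e \in arcs H ->
  (e \in din H [set v]) = (tail H e != head H e) && (head H e == v).
Proof.
move=> He; rewrite !inE He /=.
by case: (head H e =P v) => [->|_]; rewrite ?andbF ?andbT.
Qed.

Lemma entering_colorP c e : proper_ends ->
  reflect [/\ e \in arcs H, tail H e != head H e & hcolor e = c]
          (e \in entering_color H f c).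
Proof.
move=> endsH; apply: (iffP bigcupP) => [[v]|[He nl <-]].
  rewrite inE => /andP[_ /eqP <-] Hd.
  have He : e \in arcs H by move: Hd; rewrite inE => /andP[].
  by move: Hd; rewrite din1E // => /andP[nl /eqP <-].
by exists (head H e); rewrite ?din1E ?nl ?eqxx // inE eqxx (endsH e He).2.
Qed.

Lemma sourced_neq B e : proper_ends -> B \subset arcs H -> sourced B ->
  e \in B -> tail H e != head H e.
Proof.
move=> endsH /subsetP sB srcB eB; apply/eqP => E.
have [||v] := srcB [set head H e].
- by rewrite sub1set (endsH e (sB e eB)).2.
- by apply/set0Pn; exists (head H e); rewrite inE.
by rewrite inE => /eqP -> /(_ e eB erefl); rewrite E inE eqxx.
Qed.

Lemma mem_covered B v : proper_ends -> B \subset arcs H ->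
  {in B, forall e, tail H e != head H e} ->
  reflect (exists2 e, e \in B & head H e = v) (v \in covered H B).
Proof.
move=> endsH /subsetP sB nlB; rewrite inE; apply: (iffP andP) => [[_ /set0Pn[e]]|[e eB <-]].
  rewrite inE => /andP[eB]; rewrite din1E ?sB // => /andP[_ /eqP <-].
  by exists e.
split; first by rewrite (endsH e (sB e eB)).2.
by apply/set0Pn; exists e; rewrite inE eB din1E ?sB // nlB //= eqxx.
Qed.

Lemma coversP B c : proper_ends -> B \subset arcs H ->
  {in B, forall e, tail H e != head H e} ->
  reflect (exists2 e, e \in B & hcolor e = c)
          (covered H B :&: color_class H f c != set0).
Proof.
move=> endsH sB nlB; apply: (iffP (set0Pn _)) => [[v]|[e eB E]].
  rewrite !inE => /andP[vB /andP[_ /eqP fv]].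
  have /(mem_covered v endsH sB nlB)[e eB E] : v \in covered H B by rewrite inE.
  by exists e => //; rewrite /hcolor E.
exists (head H e); rewrite in_setI; apply/andP; split.
  by apply/(mem_covered _ endsH sB nlB); exists e.
by rewrite inE (endsH e (subsetP sB e eB)).2 -E eqxx.
Qed.

(** Carries membership and distinctness over from heads to tails, since [directed_cycle] asks only
    for distinct heads. *)
Lemma cycle_heads (p : seq A) : cycle [rel a b | head H a == tail H b] p ->
  [seq head H a | a <- p] = rot 1 [seq tail H a | a <- p].
Proof.
case: p => //= x s; rewrite rot1_cons -map_rcons.
elim: s {1 3}x => [|y s IHs] z /=; first by move=> /andP[/eqP -> _].
by move=> /andP[/eqP -> /IHs ->].
Qed.

(** * Directed cycles *)

Section DirectedCycle.
Variables (K : {set A}) (dcK : directed_cycle H K).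
Let Z := cycle_nodes H K.

Lemma dcycle_arcs : K \subset arcs H.
Proof. by case: dcK => p [_ sp _ _ ->]; apply/subsetP => a; rewrite inE => /sp. Qed.

Lemma dcycle_neq0 : K != set0.
Proof.
case: dcK => -[|x p] [//= _ _ _ _ ->].
by apply/set0Pn; exists x; rewrite !inE eqxx.
Qed.

Lemma dcycle_head e : e \in K -> head H e \in Z.
Proof. by move=> eK; apply: imset_f. Qed.

Lemma dcycle_tail e : e \in K -> tail H e \in Z.
Proof.
case: dcK => p [_ _ cp _ EK]; rewrite EK inE => ep.
have : tail H e \in [seq head H a | a <- p].
  by rewrite (cycle_heads cp) mem_rot map_f.
by case/mapP => b bp ->; apply: dcycle_head; rewrite EK inE.
Qed.

Lemma dcycle_head_inj : {in K &, injective (head H)}.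
Proof.
case: dcK => p [_ _ _ up ->] a b; rewrite !inE => ap bp E.
elim: p up ap bp => //= x p IHp /andP[xp /IHp {}IHp].
rewrite !inE => /orP[/eqP Ea|ap] /orP[/eqP Eb|bp]; rewrite ?Ea ?Eb //; last exact: IHp.
  by rewrite -Ea E map_f in xp.
by rewrite -Eb -E map_f in xp.
Qed.

(* The node of Y that comes first on K when K is traversed from the head of a. *)
Lemma dcycle_source a Y : a \in K -> Y \subset Z -> Y != set0 ->
  exists2 v, v \in Y & forall e, e \in K -> e != a -> head H e = v -> tail H e \notin Y.
Proof.
move=> aK sYZ /set0Pn[y yY].
have inj := dcycle_head_inj.
case: (boolP (head H a \in Y)) => [aY|aNY].
  exists (head H a) => // e eK nea E; case/eqP: nea; exact: inj.
suff [v vY Pv] : exists2 v, v \in Y & forall e, e \in K -> head H e = v -> tail H e \notin Y.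
  by exists v => // e eK _; apply: Pv.
have [p [_ _ cp up EK]] := dcK.
have ap : a \in p by rewrite EK inE in aK.
have [i q Eq] := rot_to ap.
have memq e : (e \in K) = (e \in a :: q) by rewrite EK inE -Eq mem_rot.
have : path [rel b c | head H b == tail H c] a q.
  have : cycle [rel b c | head H b == tail H c] (a :: q) by rewrite -Eq rot_cycle.
  by rewrite /= rcons_path => /andP[].
have : has (fun e => head H e \in Y) q.
  have /imsetP[e eK Ey] := subsetP sYZ y yY.
  apply/hasP; exists e; rewrite -?Ey //.
  by move: eK; rewrite memq inE => /orP[/eqP Ea|//]; rewrite -Ea -Ey yY in aNY.
have : {subset q <= K} by move=> e eq; rewrite memq inE eq orbT.
elim: q (a) aNY {Eq memq} => //= b q IHq x xNY sq.
case: (boolP (head H b \in Y)) => [bY _|bNY /=].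
  move=> /andP[/eqP Exb _]; exists (head H b) => // e eK E.
  have -> : e = b by apply: inj => //; apply: sq; rewrite inE eqxx.
  by rewrite -Exb.
move=> hq /andP[_ pq]; apply: (IHq b) => // e eq.
by apply: sq; rewrite inE eq orbT.
Qed.

Lemma dcycle_undirected : exists p, undirected_cycle H p /\ {subset [seq x.1 | x <- p] <= K}.
Proof.
case: dcK => p [p0 sp cp up ->].
exists [seq (a, true) | a <- p].
have E1 : [seq x.1 | x <- [seq (a, true) | a <- p]] = p by rewrite -map_comp map_id_in.
split; last by rewrite E1 => e; rewrite inE.
split; rewrite ?E1 //.
- by case: p p0 {E1 sp cp up}.
- by rewrite cycle_map.
- rewrite -map_comp (_ : map _ p = map (tail H) p); last exact: eq_map.
  by rewrite -(rot_uniq 1) -(cycle_heads cp).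
- exact: (map_uniq up).
Qed.

End DirectedCycle.

(** Choosing for each node of [X] an arc of [B] that enters it from [X] gives a self-map of [X], the
    tail of the chosen arc. On a stable subset where this map is injective, its orbits are directed
    cycles traversed backward. *)
Lemma dcycle_exists B X : B \subset arcs H -> X != set0 ->
  (forall v, v \in X -> exists e, [/\ e \in B, head H e = v & tail H e \in X]) ->
  exists2 K, directed_cycle H K & K \subset B.
Proof.
move=> /subsetP sB X0 preX.
have [v0 v0X] := set0Pn _ X0.
have [e0 _] := preX v0 v0X.
pose pa v := odflt e0 [pick e in B | (head H e == v) && (tail H e \in X)].
have paP v : v \in X -> [/\ pa v \in B, head H (pa v) = v & tail H (pa v) \in X].
  move=> vX; rewrite /pa; case: pickP => [e /and3P[eB /eqP hv tX]|none] //=.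
  have [e [eB hv tX]] := preX v vX.
  by have := none e; rewrite eB hv eqxx tX.
pose g v := tail H (pa v).
(* Replacing a set by its image under [g] shrinks it until [g] is injective. *)
have [Y [Y0 sYX gY gI]] : exists Y, [/\ Y != set0, Y \subset X,
    {in Y, forall x, g x \in Y} & {in Y &, injective g}].
  have gX : {in X, forall x, g x \in X} by move=> x /paP[].
  suff shrink n : forall Y, (#|Y| < n)%N -> Y \subset X -> Y != set0 ->
      {in Y, forall x, g x \in Y} -> exists Y, [/\ Y != set0, Y \subset X,
      {in Y, forall x, g x \in Y} & {in Y &, injective g}].
    exact: shrink (leqnn _) (subxx X) X0 gX.
  elim: n => // n IHn Y leY sYX Y0 gY.
  case: (boolP (#|g @: Y| == #|Y|)) => [/imset_injP gI|neY].
    by exists Y.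
  have sgY : g @: Y \subset Y by apply/subsetP => _ /imsetP[x xY ->]; apply: gY.
  have ltY : (#|g @: Y| < #|Y|)%N by rewrite ltn_neqAle neY leq_imset_card.
  apply: (IHn (g @: Y)).
  - exact: leq_trans ltY _.
  - exact: subset_trans sgY sYX.
  - have [x xY] := set0Pn _ Y0.
    by apply/set0Pn; exists (g x); apply: imset_f.
  - by move=> x /(subsetP sgY) xY; apply: imset_f.
have [v vY] := set0Pn _ Y0.
have sorb : {subset orbit g v <= Y}.
  move=> x; rewrite -fconnect_orbit => /iter_findex <-.
  by elim: (findex _ _ _) => //= n; apply: gY.
have cyc := cycle_orbit_in gY gI vY.
have orbP x : x \in orbit g v -> [/\ pa x \in B, head H (pa x) = x & tail H (pa x) \in X].
  by move=> /sorb/(subsetP sYX); apply: paP.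
(* [g] leads from head to tail, so the orbit is reversed to follow the arcs. *)
exists [set e in [seq pa x | x <- rev (orbit g v)]]; last first.
  by apply/subsetP => e; rewrite inE => /mapP[x]; rewrite mem_rev => /orbP[xB _ _] ->.
exists [seq pa x | x <- rev (orbit g v)]; split=> //.
- rewrite -size_eq0 size_map size_rev size_orbit -lt0n; exact: order_gt0.
- by move=> e /mapP[x]; rewrite mem_rev => /orbP[xB _ _] ->; apply: sB.
- rewrite cycle_map rev_cycle; apply: (sub_in_cycle (P := mem (orbit g v))) cyc; last exact/allP.
  move=> x y _ yo /= /eqP Exy; have [_ hy _] := orbP y yo.
  by rewrite hy -Exy.
- rewrite -map_comp map_id_in ?rev_uniq ?orbit_uniq //.
  by move=> x; rewrite mem_rev => /orbP[].
Qed.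

(** A nonempty set without a source is what [dcycle_exists] asks for. Hence the cycle test of a
    primal step decides whether the added arc preserves [sourced]. *)
Lemma dcycle_or_sourced B : B \subset arcs H ->
  sourced B \/ exists2 K, directed_cycle H K & K \subset B.
Proof.
move=> sB.
case: (boolP [exists X : {set N}, (X != set0) &&
   [forall v in X, exists e in B, (head H e == v) && (tail H e \in X)]]).
  move=> /existsP[X /andP[X0 /forall_inP preX]]; right.
  apply: (dcycle_exists sB X0) => v /preX /exists_inP[e eB /andP[/eqP hv tX]].
  by exists e.
rewrite negb_exists => /forallP none; left => X _ X0.
have := none X; rewrite X0 /= negb_forall => /existsP[v].
rewrite negb_imply negb_exists => /andP[vX /forallP nov].
exists v => // e eB hv; have := nov e; rewrite eB hv eqxx /=.
by [].
Qed.

(** An undirected cycle has as many arcs as nodes. The heads of its arcs are distinct, so they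
    exhaust its nodes, including the source of its node set; yet the arc entering that source has
    its tail on the cycle. *)
Lemma sourced_acyclic B : proper_ends -> B \subset arcs H ->
  {in B &, injective (head H)} -> sourced B -> acyclic H B.
Proof.
move=> endsH /subsetP sB injB srcB p [p0 sp cp us ua] pB.
pose X := [set v in [seq trav_src H x | x <- p]].
have dstX x : x \in p -> trav_dst H x \in X.
  move=> xp; have := next_cycle cp xp; rewrite /= => /eqP ->.
  by rewrite inE map_f // mem_next.
have endX x : x \in p -> (tail H x.1 \in X) && (head H x.1 \in X).
  move=> xp; have := dstX x xp.
  have : trav_src H x \in X by rewrite inE map_f.
  by rewrite /trav_src /trav_dst; case: x.2 => -> ->.
have sX : X \subset nodes H.
  apply/subsetP => v; rewrite inE => /mapP[x xp ->].
  have /sp/endsH[] : x.1 \in [seq y.1 | y <- p] by apply: map_f.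
  by rewrite /trav_src; case: x.2.
have X0 : X != set0.
  case: p p0 @X {sp cp us ua pB dstX endX sX} => // x p _ X.
  by apply/set0Pn; exists (trav_src H x); rewrite !inE eqxx.
have [v vX src] := srcB X sX X0.
pose E := [set e in [seq x.1 | x <- p]].
have cE : #|[set head H e | e in E]| = #|X|.
  rewrite card_in_imset; last by move=> a b; rewrite !inE => /pB aB /pB bB; apply: injB.
  by rewrite !cardsE (card_uniqP ua) (card_uniqP us) !size_map.
have sE : [set head H e | e in E] \subset X.
  by apply/subsetP => _ /imsetP[e + ->]; rewrite inE => /mapP[x /endX/andP[_ ?] ->].
have : v \in [set head H e | e in E].
  by rewrite (subset_cardP cE sE).
case/imsetP => e; rewrite inE => ep Ev.
have := src e (pB e ep) (esym Ev).
by case/mapP: ep => x /endX/andP[tX _] ->; rewrite tX.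
Qed.

(** Needed for the competitors: a directed cycle would also be an undirected one, so
    [dcycle_or_sourced] yields the sources. *)
Lemma matroid_branching_forest B : proper_ends -> matroid_branching H f B ->
  rainbow_forest B.
Proof.
move=> endsH [[sB acB inB] [_ rB]].
have srcB : sourced B.
  case: (dcycle_or_sourced sB) => // -[K dcK sK].
  have [p [ucp sp]] := dcycle_undirected dcK.
  by case: (acB p ucp) => e /sp; apply: (subsetP sK).
have nl e : e \in B -> tail H e != head H e by apply: sourced_neq.
split=> // a b aB bB E.
have hN e : e \in B -> head H e \in nodes H by move=> /(subsetP sB)/endsH[].
have cN e : e \in B -> head H e \in covered H B :&: color_class H f (hcolor e).
  move=> eB; rewrite in_setI inE [X in _ && X]inE hN //= eqxx andbT.
  by apply/set0Pn; exists e; rewrite inE eB din1E ?(subsetP sB) ?nl ?eqxx.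
have Eh : head H a = head H b.
  have /card_le1_eqP eqc := rB (hcolor a).
  by have ca := cN a aB; have := cN b bB; rewrite -E => cb; apply: eqc.
have /card_le1_eqP := inB (head H a) (hN a aB).
by apply; rewrite inE ?aB ?bB din1E ?(subsetP sB) ?nl ?Eh ?eqxx.
Qed.

Lemma forest_matroid_branching B : proper_ends -> rainbow_forest B ->
  matroid_branching H f B.
Proof.
move=> endsH [sB iB srcB].
have nl e : e \in B -> tail H e != head H e by apply: sourced_neq.
split; first split=> //.
- by apply: sourced_acyclic => // a b aB bB E; apply: iB; rewrite // /hcolor E.
- move=> v _; apply/card_le1_eqP => a b.
  rewrite !in_setI => /andP[aB +] /andP[bB]; rewrite !din1E ?(subsetP sB) //.
  by move=> /andP[_ /eqP Ea] /andP[_ /eqP Eb]; apply: iB; rewrite // /hcolor Ea Eb.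
split; first by apply/subsetP => v; rewrite inE => /andP[].
move=> c; apply/card_le1_eqP => u v; rewrite !in_setI.
move=> /andP[/(mem_covered _ endsH sB nl)[a aB <-]] + /andP[/(mem_covered _ endsH sB nl)[b bB <-]].
rewrite !inE => /andP[_ /eqP Ea] /andP[_ /eqP Eb].
by congr head; apply: iB; rewrite // /hcolor Ea Eb.
Qed.

(** The heads of the arcs of [B] inside [X] are distinct and miss the source of [X]. *)
Lemma sourced_gamma B X : B \subset arcs H -> {in B &, injective (head H)} -> sourced B ->
  X \subset nodes H -> (#|B :&: gamma H X| <= #|X|.-1)%N.
Proof.
move=> sB iB srcB sX; case: (eqVneq X set0) => [->|X0].
  by rewrite cards0 leqn0 cards_eq0; apply/eqP/setP => e; rewrite !inE !andbF.
have [v vX src] := srcB X sX X0.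
rewrite (cardsD1 v X) vX /= -(card_in_imset (f := head H) (D := B :&: gamma H X)); last first.
  by move=> a b; rewrite !in_setI => /andP[aB _] /andP[bB _]; apply: iB.
apply/subset_leq_card/subsetP => _ /imsetP[e + ->].
rewrite !inE => /andP[eB /and3P[_ tX ->]]; rewrite andbT.
by apply/eqP => /(src e eB); rewrite tX.
Qed.

End Digraphs.

(** * The augmented digraph, seen through its root [s], and its quotients *)

Section Algorithm.
Variables (R : realFieldType) (k : nat) (V A : finType).
Variables (G : digraph V A) (color : V -> 'I_k) (w : A -> R) (s : V).
Hypothesis nodesG : nodes G = setT.
Hypothesis arcsG : arcs G = setT.
Hypothesis head_root : forall e, head G e != s.
Hypothesis root_arc : forall v, v != s -> exists2 e, tail G e = s & head G e = v.
Hypothesis color_surj : forall j, exists2 v, v != s & color v = j.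

Local Notation cdigraph := (cdigraph V A).
Local Notation ccolor := (ccolor k).
Implicit Types (H : cdigraph) (f : {set V} -> ccolor) (B K : {set A}) (e : A).
Implicit Types (X Y Q : {set V}) (Z : {set {set V}}).

(* The invariant of the graphs G^i obtained by contraction and of their colorings. *)
Record quotient H f : Prop := Quotient {
  node_exists : forall v, exists2 X, X \in nodes H & v \in X;
  node_eq : forall X Y v, X \in nodes H -> Y \in nodes H -> v \in X -> v \in Y -> X = Y;
  node_inhabited : forall X, X \in nodes H -> exists v, v \in X;
  quotient_ends : proper_ends H;
  tail_in : forall e, e \in arcs H -> tail G e \in tail H e;
  head_in : forall e, e \in arcs H -> head G e \in head H e;
  lost_arc : forall e, e \notin arcs H ->
    exists X, [/\ X \in nodes H, tail G e \in X & head G e \in X];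
  color_in : forall X v, X \in nodes H -> v \in X -> color v \in f X;
  color_eq : forall X Y j, X \in nodes H -> Y \in nodes H -> j \in f X -> j \in f Y ->
    f X = f Y;
  root_node : [set s] \in nodes H }.

(** [rc_neq] excludes cycles of length one, so that contracting lowers the number of nodes. *)
Record rainbow_cycle H f K : Prop := RainbowCycle {
  rc_cycle : directed_cycle H K;
  rc_inj : {in K &, injective (hcolor H f)};
  rc_neq : {in K, forall e, tail H e != head H e} }.

(** [contract_color] as a map on colors: on nodes of [H] outside [Z] it depends only on the old
    color. *)
Definition merge f Z (c : ccolor) : ccolor :=
  if c \in [set f Y | Y in Z] then \bigcup_(Y in Z) f Y else c.

Lemma quotient_uncontracted : quotient (uncontracted G) (uncontracted_color color).
Proof.
split=> //=.
- by move=> v; exists [set v]; rewrite ?inE // imset_f // nodesG inE.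
- move=> X Y v /imsetP[x _ ->] /imsetP[y _ ->].
  by rewrite !inE => /eqP <- /eqP <-.
- by move=> X /imsetP[x _ ->]; exists x; rewrite inE.
- by move=> e _; split; apply: imset_f; rewrite nodesG inE.
- by move=> e _; rewrite inE.
- by move=> e _; rewrite inE.
- by move=> e; rewrite arcsG inE.
- by move=> X v _ vX; apply: imset_f.
- move=> X Y j /imsetP[x _ ->] /imsetP[y _ ->].
  by rewrite /uncontracted_color !imset_set1 !inE => /eqP <- /eqP <-.
- by apply: imset_f; rewrite nodesG inE.
Qed.

(** * Contraction of a node set *)

Section Contraction.
Variables (H : cdigraph) (f : {set V} -> ccolor) (Z : {set {set V}}).
Hypotheses (qH : quotient H f) (sZ : Z \subset nodes H).
Let H' := contract H Z.
Let f' := contract_color f Z.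
Let U := \bigcup_(Y in Z) f Y.

Lemma mem_cover_node X v : X \in nodes H -> v \in X -> (v \in cover Z) = (X \in Z).
Proof.
move=> XH vX; apply/bigcupP/idP => [[Y YZ vY]|XZ]; last by exists X.
by rewrite (node_eq qH XH (subsetP sZ Y YZ) vX vY).
Qed.

(** Nodes are nonempty and disjoint, so the union that names the composite node is not the name of a
    remaining node. *)
Lemma neq_cover X : X \in nodes H -> X \notin Z -> X != cover Z.
Proof.
move=> XH XZ; have [v vX] := node_inhabited qH XH.
by apply: contraNneq XZ => E; rewrite -(mem_cover_node XH vX) -E.
Qed.

Lemma contract_arcP e :
  reflect (e \in arcs H /\ ~ (tail H e \in Z /\ head H e \in Z)) (e \in arcs H').
Proof.
rewrite !inE; case: (e \in arcs H); rewrite ?andbF ?andbT /=; last by constructor; case.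
by apply: (iffP negP) => [h|[_ h]]; [split=> // /andP | move/andP].
Qed.

Lemma contract_arcs : arcs H' \subset arcs H.
Proof. exact: subsetDl. Qed.

Lemma contract_tail e : e \in arcs H' ->
  tail H' e = if tail H e \in Z then cover Z else tail H e.
Proof.
move=> /contract_arcP[eH ng] /=; rewrite inE eH /=.
by case tZ: (tail H e \in Z); case hZ: (head H e \in Z) => //=; case: ng.
Qed.

Lemma contract_head e : e \in arcs H' ->
  head H' e = if head H e \in Z then cover Z else head H e.
Proof.
move=> /contract_arcP[eH ng] /=; rewrite inE eH /=.
by case tZ: (tail H e \in Z); case hZ: (head H e \in Z) => //=; case: ng.
Qed.

Lemma contract_color_cover : f' (cover Z) = U.
Proof. by rewrite /f' /contract_color eqxx. Qed.

Lemma contract_color_node X : X \in nodes H -> X \notin Z -> f' X = merge f Z (f X).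
Proof.
by move=> XH XZ; rewrite /f' /contract_color (negPf (neq_cover XH XZ)).
Qed.

Lemma contract_hcolor e : e \in arcs H' -> hcolor H' f' e = merge f Z (hcolor H f e).
Proof.
move=> eH'; have eH := subsetP contract_arcs e eH'.
rewrite /hcolor (contract_head eH'); case: ifPn => hZ.
  by rewrite contract_color_cover /merge imset_f.
by rewrite contract_color_node // (quotient_ends qH eH).2.
Qed.

Lemma contract_nodeP X :
  reflect (X = cover Z \/ X \in nodes H /\ X \notin Z) (X \in nodes H').
Proof.
rewrite !inE; apply: (iffP orP) => -[].
- by move/eqP; left.
- by case/andP; right.
- by move=> ->; left.
- by case=> -> ->; right.
Qed.

(** Otherwise an original color in [f X] would lie in the color of a node of [Z], and current colors
    that meet are equal. *)
Lemma merge_neq X : X \in nodes H -> f X \notin [set f Y | Y in Z] -> f X != U.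
Proof.
move=> XH; apply: contraNneq => E.
have [v vX] := node_inhabited qH XH.
have /bigcupP[Y YZ cY] : color v \in U by rewrite -E; exact: (color_in qH XH vX).
by rewrite (color_eq qH XH (subsetP sZ Y YZ) (color_in qH XH vX) cY) imset_f.
Qed.

Lemma merge_sub X j : j \in f X -> j \in merge f Z (f X).
Proof.
move=> jX; rewrite /merge; case: ifP => // /imsetP[Y YZ E].
by apply/bigcupP; exists Y; rewrite -?E.
Qed.

Lemma merge_color_eq X Y j : X \in nodes H -> Y \in nodes H ->
  j \in merge f Z (f X) -> j \in merge f Z (f Y) -> merge f Z (f X) = merge f Z (f Y).
Proof.
move=> XH YH; rewrite /merge; case: ifPn => cX; case: ifPn => cY // jX jY.
- move: jX => /bigcupP[Y2 Y2Z jY2]; case/negP: cY.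
  by rewrite (color_eq qH YH (subsetP sZ _ Y2Z) jY jY2) imset_f.
- move: jY => /bigcupP[Y2 Y2Z jY2]; case/negP: cX.
  by rewrite (color_eq qH XH (subsetP sZ _ Y2Z) jX jY2) imset_f.
- exact: (color_eq qH XH YH jX jY).
Qed.

Lemma quotient_contract : Z != set0 -> [set s] \notin Z -> quotient H' f'.
Proof.
move=> /set0Pn[X0 X0Z] sNZ.
have X0H := subsetP sZ X0 X0Z.
have node' X : X \in nodes H -> (if X \in Z then cover Z else X) \in nodes H'.
  by move=> XH; apply/contract_nodeP; case: ifPn => XZ; [left|right].
have mem' X v : v \in X -> v \in (if X \in Z then cover Z else X).
  by case: ifP => // XZ vX; apply/bigcupP; exists X.
have col' X : X \in nodes H' -> exists Y, [/\ Y \in nodes H, f' X = merge f Z (f Y) &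
    forall v, v \in X -> color v \in merge f Z (f Y)].
  move=> /contract_nodeP[->|[XH XZ]].
    exists X0; rewrite contract_color_cover /merge imset_f //; split=> // v /bigcupP[Y YZ vY].
    by apply/bigcupP; exists Y; rewrite ?(color_in qH) ?(subsetP sZ).
  exists X; split=> //; first exact: contract_color_node.
  by move=> v vX; apply: merge_sub; exact: (color_in qH XH vX).
split.
- move=> v; have [X XH vX] := node_exists qH v.
  by exists (if X \in Z then cover Z else X); [exact: node'|exact: mem'].
- move=> X Y v /contract_nodeP[->|[XH XZ]] /contract_nodeP[->|[YH YZ]] //.
  + by move=> vZ vY; rewrite (mem_cover_node YH vY) (negPf YZ) in vZ.
  + by move=> vX vZ; rewrite (mem_cover_node XH vX) (negPf XZ) in vZ.
  + exact: (node_eq qH XH YH).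
- move=> X /contract_nodeP[->|[XH _]]; last exact: (node_inhabited qH XH).
  have [v vX] := node_inhabited qH X0H.
  by exists v; apply/bigcupP; exists X0.
- move=> e eH'; have eH := subsetP contract_arcs e eH'.
  rewrite (contract_tail eH') (contract_head eH').
  by have [tH hH] := quotient_ends qH eH; split; apply: node'.
- move=> e eH'; have eH := subsetP contract_arcs e eH'.
  by rewrite (contract_tail eH'); apply: mem'; exact: (tail_in qH eH).
- move=> e eH'; have eH := subsetP contract_arcs e eH'.
  by rewrite (contract_head eH'); apply: mem'; exact: (head_in qH eH).
- move=> e eNH'; case: (boolP (e \in arcs H)) => [eH|/(lost_arc qH)[X [XH tX hX]]].
    have [tZ hZ] : tail H e \in Z /\ head H e \in Z.
      apply/andP; apply: contraNT eNH' => ng; apply/contract_arcP; split=> //.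
      by move/andP; apply/negP.
    exists (cover Z); split; first by apply/contract_nodeP; left.
      by apply/bigcupP; exists (tail H e) => //; exact: (tail_in qH eH).
    by apply/bigcupP; exists (head H e) => //; exact: (head_in qH eH).
  by exists (if X \in Z then cover Z else X); split; [exact: node'|exact: mem'|exact: mem'].
- by move=> X v /col'[Y [_ -> h]] /h.
- move=> X Y j /col'[X1 [X1H -> _]] /col'[Y1 [Y1H -> _]].
  exact: merge_color_eq.
- by have := node' _ (root_node qH); rewrite (negPf sNZ).
Qed.

Lemma card_contract : (1 < #|Z|)%N -> (#|nodes H'| < #|nodes H|)%N.
Proof.
move=> Z1; have := cardsID Z (nodes H); rewrite (setIidPr sZ) => <-.
by rewrite cardsU1; case: (_ \notin _); lia.
Qed.

End Contraction.

(** Only colors of nodes are asked for: an arbitrary [c : ccolor] need not be a current color. *)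
Definition covers_nodes H f B :=
  forall X, X \in nodes H -> exists2 e, e \in B & hcolor H f e = f X.

(* When all contractions in Q are undone (H = G), such a B has |Q| - 1 arcs inside Q. *)
Definition spanned H B Q :=
  (forall X, X \in nodes H -> X \subset Q \/ [disjoint X & Q]) /\
  exists X0, forall X, X \in nodes H -> X \subset Q -> X != X0 ->
    exists e, [/\ e \in B, head H e = X & tail H e \subset Q].

Lemma restoration_someP (S : state R k V A) B K B1 :
  let H := st_graph S in let Z := cycle_nodes H K in let H' := contract H Z in
  restoration_step S B (Some K) B1 ->
  exists a, [/\ a \in K, B1 = B :|: (K :\ a) &
    B :&: din H' [set cover Z] = set0 /\
      rainbow H (st_color S) (covered H' B :|: (Z :\ head H a)) \/
    exists2 b, b \in B :&: din H' [set cover Z] & head H a = head H b].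
Proof.
move=> H Z H' st; move EK : (Some K) st => l st; case: st EK => // K1.
  by move=> u a H1 Z1 H1' nB uZ rain aK hu [EK]; subst K1 u; exists a; split=> //; left.
by move=> b a H1 Z1 H1' bB aK hab [EK]; subst K1; exists a; split=> //; right; exists b.
Qed.

(** * Contraction and restoration of a cycle *)

Section CycleContraction.
Variables (H : cdigraph) (f : {set V} -> ccolor) (K : {set A}).
Hypotheses (qH : quotient H f) (rcK : rainbow_cycle H f K).
Let Z := cycle_nodes H K.
Let H' := contract H Z.
Let f' := contract_color f Z.
Let U := \bigcup_(Y in Z) f Y.
Let dcK := rc_cycle rcK.
Let sKH : {subset K <= arcs H} := subsetP (dcycle_arcs dcK).

Lemma cycle_nodes_sub : Z \subset nodes H.
Proof.
by apply/subsetP => _ /imsetP[e /sKH eH ->]; exact: (quotient_ends qH eH).2.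
Qed.
Let sZ := cycle_nodes_sub.

Lemma cycle_nodes_neq0 : Z != set0.
Proof.
by have /set0Pn[e eK] := dcycle_neq0 dcK; apply/set0Pn; exists (head H e); apply: dcycle_head.
Qed.

(** Every node of a directed cycle is the head of one of its arcs, and no arc of [G] enters [s]. *)
Lemma root_notin_cycle : [set s] \notin Z.
Proof.
apply/imsetP => -[e /sKH eH E].
by have := head_in qH eH; rewrite -E inE (negPf (head_root e)).
Qed.

Lemma cycle_nodes_gt1 : (1 < #|Z|)%N.
Proof.
have /set0Pn[e eK] := dcycle_neq0 dcK.
rewrite (cardsD1 (tail H e)) (dcycle_tail dcK eK) (cardsD1 (head H e)) !inE.
by rewrite eq_sym (rc_neq rcK eK) (dcycle_head H eK).
Qed.

Lemma quotient_contract_cycle : quotient H' f'.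
Proof. exact: (quotient_contract qH sZ cycle_nodes_neq0 root_notin_cycle). Qed.
Let qH' := quotient_contract_cycle.

Lemma cycle_color_inj : {in Z &, injective f}.
Proof.
by move=> _ _ /imsetP[a aK ->] /imsetP[b bK ->] E; rewrite (rc_inj rcK aK bK E).
Qed.

Lemma cycle_hcolor e : e \in K -> hcolor H f e \in [set f Y | Y in Z].
Proof. by move=> eK; apply: imset_f; apply: dcycle_head. Qed.

Lemma cycle_arc_lost e : e \in K -> e \notin arcs H'.
Proof.
move=> eK; apply/contract_arcP => -[_]; case; split.
  exact: (dcycle_tail dcK eK).
exact: dcycle_head.
Qed.

Lemma cover_node : cover Z \in nodes H'.
Proof. by apply/contract_nodeP; left. Qed.

Lemma hcolor_coverP e : e \in arcs H' ->
  (hcolor H' f' e == U) = (hcolor H f e \in [set f Y | Y in Z]).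
Proof.
move=> eH'; have eH := subsetP (contract_arcs H Z) e eH'.
rewrite (contract_hcolor qH sZ eH') /merge; case: ifPn => [|cN]; first by rewrite eqxx.
exact: (negPf (merge_neq qH sZ (quotient_ends qH eH).2 cN)).
Qed.

Lemma hcolor_other e : e \in arcs H' -> hcolor H f e \notin [set f Y | Y in Z] ->
  hcolor H' f' e = hcolor H f e.
Proof. by move=> eH' cN; rewrite (contract_hcolor qH sZ eH') /merge (negPf cN). Qed.

Section Contracted.
Variables (B : {set A}) (a : A).
Hypothesis (rfB : rainbow_forest H f B).
Hypotheses (aB : {in B, forall b, hcolor H f b != hcolor H f a}) (sK : K \subset a |: B).

(** An arc of [B] with the head color of some [d] in [K] is [d] itself, since [K] lies in [a |: B]
    and [B] does not cover the color of [a]; so it is in [gamma H Z] and gets removed. The merged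
    color is thus left uncovered. *)
Lemma contract_head_notin e : e \in B :\: gamma H Z ->
  hcolor H f e \notin [set f Y | Y in Z].
Proof.
rewrite in_setD => /andP[eg eB]; apply: contra eg => /imsetP[_ /imsetP[d dK ->] E].
have eH := subsetP (rf_arcs rfB) e eB.
have -> : e = d.
  have := subsetP sK d dK; rewrite !inE => /orP[/eqP Ed|dB].
    by case/eqP: (aB eB); rewrite -Ed.
  exact: (rf_inj rfB eB dB E).
by rewrite inE (sKH dK) (dcycle_tail dcK dK) dcycle_head.
Qed.

Lemma forest_contract : rainbow_forest H' f' (B :\: gamma H Z).
Proof.
have sB : B :\: gamma H Z \subset arcs H' by apply: setSD; apply: rf_arcs rfB.
have hN e : e \in B :\: gamma H Z -> head H e \notin Z.
  by move=> /contract_head_notin; apply: contra => hZ; apply: imset_f.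
split=> //.
- move=> d e dB eB; rewrite !hcolor_other ?(contract_head_notin) ?(subsetP sB) //.
  by move: dB eB; rewrite !in_setD => /andP[_ dB] /andP[_ eB]; exact: (rf_inj rfB dB eB).
- move=> X sX X0; case: (boolP (cover Z \in X)) => [UX|UNX].
    (* No remaining arc enters the composite node, so it is a source vacuously. *)
    exists (cover Z) => // e eB; rewrite (contract_head (subsetP sB e eB)) (negPf (hN e eB)).
    move=> E; have /negP[] := hN e eB; rewrite E.
    have eH := subsetP (rf_arcs rfB) e (subsetP (subsetDl _ _) e eB).
    have := neq_cover qH sZ (quotient_ends qH eH).2 (hN e eB).
    by rewrite E eqxx.
  have XH X1 : X1 \in X -> X1 \in nodes H /\ X1 \notin Z.
    move=> X1X; have /contract_nodeP[E|//] := subsetP sX X1 X1X.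
    by rewrite -E X1X in UNX.
  have [|v vX src] := rf_sourced rfB _ X0; first by apply/subsetP => X1 /XH[].
  exists v => // e eB; have [eB0 _] := setDP eB.
  rewrite (contract_head (subsetP sB e eB)) (negPf (hN e eB)) => /(src e eB0).
  by rewrite (contract_tail (subsetP sB e eB)); case: ifP.
Qed.

End Contracted.

(* Whether or not the composite node is covered, the merged color is covered by an arc e0
   whose color in H is the one left uncovered by removing the arc a from the cycle; this is
   all that is used on the choice of a. *)
Section Restored.
Variables (B : {set A}) (a e0 : A).
Hypotheses (rfB : rainbow_forest H' f' B) (aK : a \in K) (e0B : e0 \in B).
Hypotheses (e0U : hcolor H' f' e0 = U) (e0a : hcolor H f e0 = hcolor H f a).
Let B1 := B :|: (K :\ a).
Let sB : {subset B <= arcs H'} := subsetP (rf_arcs rfB).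
Let sBH e (eB : e \in B) : e \in arcs H := subsetP (contract_arcs H Z) e (sB eB).

(** [U] unites the colors of [Z], and [e0] is the only arc of [B] of color [U]. *)
Lemma restored_color e : e \in B -> hcolor H f e \in [set f Y | Y in Z] -> e = e0.
Proof.
move=> eB; rewrite -hcolor_coverP ?sB // => /eqP E.
by apply: (rf_inj rfB eB e0B); rewrite E e0U.
Qed.

Lemma restored_arcs : B1 \subset arcs H.
Proof.
apply/subsetP => e; rewrite !inE => /orP[/sBH //|/andP[_ /sKH]] //.
Qed.

Lemma restored_inj : {in B1 &, injective (hcolor H f)}.
Proof.
have mixed b c : b \in B -> c \in K -> c != a -> hcolor H f b != hcolor H f c.
  move=> bB cK ca; apply/eqP => E.
  have Eb : b = e0 by apply: restored_color; rewrite // E cycle_hcolor.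
  by case/eqP: ca; apply: (rc_inj rcK cK aK); rewrite -E Eb.
move=> b c; rewrite !inE => /orP[bB|/andP[ba bK]] /orP[cB|/andP[ca cK]] E.
- apply: (rf_inj rfB bB cB).
  by rewrite !(contract_hcolor qH sZ) ?sB // E.
- by case/eqP: (mixed b c bB cK ca).
- by case/eqP: (mixed c b cB bK ba).
- exact: (rc_inj rcK bK cK E).
Qed.

(** A set [X] that meets [Z] is compared with its image in [H']. If the source of the image is the
    composite node, the first node of [X :&: Z] on the path [K :\ a] is a source of [X]: arcs of [B]
    enter it from outside [X], and so does its arc of the path, if any. *)
Lemma restored_sourced : sourced H B1.
Proof.
move=> X sX X0; case: (eqVneq (X :&: Z) set0) => [XZ|XZ].
  have XN v : v \in X -> v \notin Z.
    by move=> vX; apply/negP => vZ; have := in_set0 v; rewrite -XZ inE vX vZ.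
  have [|v vX src] := rf_sourced rfB _ X0.
    by apply/subsetP => v vX; apply/contract_nodeP; right; rewrite (subsetP sX) ?XN.
  exists v => // e; rewrite !inE => /orP[eB|/andP[_ eK]] hv; last first.
    by have := XN v vX; rewrite -hv dcycle_head.
  have := src e eB; rewrite (contract_head (sB eB)) hv (negPf (XN v vX)) => /(_ erefl).
  rewrite (contract_tail (sB eB)); case: ifPn => // tZ _.
  by apply/negP => /XN; rewrite tZ.
have [||v] := rf_sourced rfB (X := cover Z |: (X :\: Z)).
- apply/subsetP => v; rewrite !inE => /orP[/eqP ->|/andP[vZ vX]].
    by rewrite eqxx.
  by rewrite vZ (subsetP sX) ?orbT.
- by apply/set0Pn; exists (cover Z); rewrite !inE eqxx.
have tX e : e \in B -> tail H e \in X -> tail H' e \in cover Z |: (X :\: Z).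
  move=> eB tX; rewrite (contract_tail (sB eB)) !inE.
  by case: ifPn => tZ; rewrite ?eqxx // tX tZ orbT.
rewrite in_setU1 => /orP[/eqP -> src|].
  have [u uXZ srcK] := dcycle_source dcK aK (subsetIr X Z) XZ.
  move: uXZ; rewrite inE => /andP[uX uZ]; exists u => // e.
  rewrite !inE => /orP[eB hv|/andP[ea eK] hv].
    apply/negP => /(tX e eB); apply/negP; apply: src => //.
    by rewrite (contract_head (sB eB)) hv uZ.
  by have := srcK e eK ea hv; rewrite inE (dcycle_tail dcK eK) andbT.
rewrite inE => /andP[vZ vX] src; exists v => // e.
rewrite !inE => /orP[eB hv|/andP[ea eK] hv]; last by rewrite -hv dcycle_head in vZ.
apply/negP => /(tX e eB); apply/negP; apply: src => //.
by rewrite (contract_head (sB eB)) hv (negPf vZ).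
Qed.

Lemma forest_restore : rainbow_forest H f B1.
Proof. by split; [exact: restored_arcs|exact: restored_inj|exact: restored_sourced]. Qed.

Lemma covers_restore : covers_nodes H' f' B -> covers_nodes H f B1.
Proof.
move=> cB X XH; case: (boolP (f X \in [set f Y | Y in Z])) => [|cN].
  move=> /imsetP[_ /imsetP[e eK ->] E].
  case: (eqVneq e a) => [Ea|ea].
    by exists e0; rewrite ?inE ?e0B // e0a E Ea.
  by exists e; rewrite ?inE ?ea ?eK ?orbT.
have XZ : X \notin Z by apply: contra cN => XZ; apply: imset_f.
have [|e eB] := cB X; first by apply/contract_nodeP; right.
have -> : f' X = f X by rewrite /f' (contract_color_node qH sZ) // /merge (negPf cN).
move=> E.
exists e; rewrite ?inE ?eB //.
rewrite -E; symmetry; apply: hcolor_other; first exact: sB.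
rewrite -(hcolor_coverP (sB eB)) E; exact: (merge_neq qH sZ XH cN).
Qed.

(** The path [K :\ a] enters all nodes of [Z] but the head of [a], which is the exceptional node. *)
Lemma spanned_cover : spanned H B1 (cover Z).
Proof.
split=> [X XH|].
  case: (boolP (X \in Z)) => XZ; [left|right].
    by apply/subsetP => v vX; apply/bigcupP; exists X.
  rewrite disjoint_subset; apply/subsetP => v vX.
  by rewrite inE (mem_cover_node qH sZ XH vX).
exists (head H a) => X XH sX Xa.
have [v vX] := node_inhabited qH XH.
have := subsetP sX v vX; rewrite (mem_cover_node qH sZ XH vX) => /imsetP[e eK E].
exists e; split=> //.
  by rewrite !inE eK andbT; apply/orP; right; apply: contraNneq Xa => <-; rewrite E.
by apply: bigcup_max (dcycle_tail dcK eK) _.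
Qed.

(** The composite node is inside [Q] or disjoint from it, and so are all nodes of [Z]. The
    exceptional node is kept unless it is the composite node, when the head of [a] replaces it. *)
Lemma spanned_restore Q : spanned H' B Q -> spanned H B1 Q.
Proof.
move=> [closedQ [X0 spanQ]].
have subZ X : X \in Z -> X \subset cover Z by move=> XZ; apply: bigcup_max XZ _.
split=> [X XH|].
  case: (boolP (X \in Z)) => XZ; last by apply: closedQ; apply/contract_nodeP; right.
  have [sU|dU] := closedQ _ cover_node; [left|right].
    exact: subset_trans (subZ X XZ) sU.
  exact: disjointWl (subZ X XZ) dU.
have sub_tail e : e \in B -> tail H' e \subset Q -> tail H e \subset Q.
  move=> eB; rewrite (contract_tail (sB eB)); case: ifP => // tZ.
  exact: subset_trans (subZ _ tZ).
have closedZ X : X \in Z -> X \subset Q -> cover Z \subset Q.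
  move=> XZ sXQ; have [//|dU] := closedQ _ cover_node.
  have [v vX] := node_inhabited qH (subsetP sZ X XZ).
  have := disjointFr dU (subsetP (subZ X XZ) v vX).
  by rewrite (subsetP sXQ v vX).
have arcK e : e \in K -> e != a -> head H e \subset Q ->
    exists e', [/\ e' \in B1, head H e' = head H e & tail H e' \subset Q].
  move=> eK ea hQ; exists e; split=> //; first by rewrite !inE ea eK orbT.
  apply: subset_trans (closedZ _ (dcycle_head H eK) hQ).
  exact: subZ (dcycle_tail dcK eK).
have arcB X : X \in nodes H -> X \notin Z -> X \subset Q -> X != X0 ->
    exists e', [/\ e' \in B1, head H e' = X & tail H e' \subset Q].
  move=> XH XZ sXQ X0X; have [|e [eB hE tQ]] := spanQ X _ sXQ X0X.
    by apply/contract_nodeP; right.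
  exists e; split; [by rewrite inE eB| |exact: sub_tail].
  move: hE; rewrite (contract_head (sB eB)); case: ifP => // _ E.
  by case/eqP: (neq_cover qH sZ XH XZ).
case: (eqVneq X0 (cover Z)) => [EX0|neX0].
  exists (head H a) => X XH sXQ Xa; case: (boolP (X \in Z)) => [/imsetP[e eK E]|XZ].
    by rewrite E; apply: arcK; rewrite -?E //; apply: contraNneq Xa => <-; rewrite E.
  by apply: arcB; rewrite // EX0; apply: (neq_cover qH sZ).
exists X0 => X XH sXQ X0X; case: (boolP (X \in Z)) => [/imsetP[e eK E]|XZ]; last exact: arcB.
rewrite E; case: (eqVneq e a) => [Ea|ea]; last by apply: arcK; rewrite -?E.
have XZ : X \in Z by rewrite E dcycle_head.
(* The arc of [B] that enters the composite node from within [Q] has color [U], hence is [e0], and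
   in [H] it enters the head of [a]. *)
have [|e' [e'B he' te']] := spanQ _ cover_node (closedZ X XZ sXQ); first by rewrite eq_sym.
have hZ : head H e' \in Z.
  move: he'; rewrite (contract_head (sB e'B)); case: ifPn => // hN E'.
  by case/eqP: (neq_cover qH sZ (quotient_ends qH (sBH e'B)).2 hN).
exists e'; split; [by rewrite inE e'B| |exact: sub_tail].
apply: cycle_color_inj => //; first exact: dcycle_head.
by rewrite Ea -/(hcolor H f a) -e0a (restored_color e'B) //; apply: imset_f.
Qed.

End Restored.

(** The arc [e0] of the merged color enters a node outside [Z] that shares its color in [H] with
    exactly one node of [Z]; leaving that node out resolves the only conflict. *)
Lemma uncovered_restorable B : rainbow_forest H' f' B -> covers_nodes H' f' B ->
  B :&: din H' [set cover Z] = set0 ->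
  exists2 a, a \in K & rainbow H f (covered H' B :|: (Z :\ head H a)).
Proof.
move=> rfB cB nB; have sB := subsetP (rf_arcs rfB).
have nl e : e \in B -> tail H' e != head H' e.
  exact: (sourced_neq (quotient_ends qH') (rf_arcs rfB) (rf_sourced rfB)).
have [e0 e0B] := cB _ cover_node; rewrite /f' contract_color_cover => e0U.
have hN e : e \in B -> head H' e != cover Z.
  move=> eB; apply/eqP => E; have := in_set0 e.
  by rewrite -nB in_setI eB (din1E _ (sB e eB)) nl // E eqxx.
have hE e : e \in B -> head H e \notin Z /\ head H' e = head H e.
  by move=> eB; have := hN e eB; rewrite (contract_head (sB e eB)); case: ifP; rewrite ?eqxx.
have sBH e : e \in B -> e \in arcs H by move/sB; apply: (subsetP (contract_arcs H Z)).
have := e0U => /eqP; rewrite (hcolor_coverP (sB e0 e0B)) => /imsetP[_ /imsetP[a aK ->] Ea].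
exists a => //.
have covP := mem_covered _ (quotient_ends qH') (rf_arcs rfB) nl.
have mixed e z : e \in B -> z \in Z :\ head H a -> hcolor H f e = f z -> False.
  move=> eB; rewrite inE => /andP[za zZ] E; case/negP: za; rewrite inE; apply/eqP.
  apply: cycle_color_inj => //; first exact: dcycle_head.
  by rewrite -E -[RHS]Ea (restored_color rfB e0B e0U eB) // E imset_f.
split.
  apply/subsetP => v; rewrite inE => /orP[/covP[e eB <-]|].
    by rewrite (hE e eB).2 (quotient_ends qH (sBH e eB)).2.
  by rewrite inE => /andP[_ /(subsetP sZ)].
move=> c; apply/card_le1_eqP => u v; rewrite !in_setI => /andP[uI uc] /andP[vI vc].
have fu : f u = c by move: uc; rewrite inE => /andP[_ /eqP].
have fv : f v = c by move: vc; rewrite inE => /andP[_ /eqP].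
move: uI vI; rewrite !in_setU => /orP[/covP[d dB Eu]|uZ] /orP[/covP[e eB Ev]|vZ].
- rewrite -Eu -Ev; congr head; apply: (rf_inj rfB) => //.
  rewrite !(contract_hcolor qH sZ) ?sB // /hcolor.
  by rewrite -(hE d dB).2 -(hE e eB).2 Eu Ev fu fv.
- by case: (mixed d v dB vZ); rewrite /hcolor -(hE d dB).2 Eu fu fv.
- by case: (mixed e u eB uZ); rewrite /hcolor -(hE e eB).2 Ev fu fv.
- move: uZ vZ; rewrite !inE => /andP[_ uZ] /andP[_ vZ].
  by apply: cycle_color_inj; rewrite // fu fv.
Qed.

(** If an arc [b] enters the composite node, [e0] is [b]; otherwise [e0] is the arc that covers the
    merged color elsewhere. *)
Lemma restoration_arc (S : state R k V A) B B1 : st_graph S = H -> st_color S = f ->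
  rainbow_forest H' f' B -> covers_nodes H' f' B -> restoration_step S B (Some K) B1 ->
  exists a e0, [/\ a \in K, e0 \in B, hcolor H' f' e0 = U,
    hcolor H f e0 = hcolor H f a & B1 = B :|: (K :\ a)].
Proof.
move=> ES Ef rfB cB; have sB := subsetP (rf_arcs rfB).
have nl e : e \in B -> tail H' e != head H' e.
  exact: (sourced_neq (quotient_ends qH') (rf_arcs rfB) (rf_sourced rfB)).
have sBH e : e \in B -> e \in arcs H by move/sB; apply: (subsetP (contract_arcs H Z)).
have covP := mem_covered _ (quotient_ends qH') (rf_arcs rfB) nl.
case/restoration_someP=> a []; rewrite ES Ef -/Z -/H' => aK -> [[nB [_ rain]]|[b + hab]].
  have [e0 e0B] := cB _ cover_node; rewrite /f' contract_color_cover => e0U.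
  have hN : head H' e0 != cover Z.
    apply/eqP => E; have := in_set0 e0.
    by rewrite -nB in_setI e0B (din1E _ (sB e0 e0B)) nl // E eqxx.
  have [hZ hE] : head H e0 \notin Z /\ head H' e0 = head H e0.
    by move: hN; rewrite (contract_head (sB e0 e0B)); case: ifP; rewrite ?eqxx.
  exists a, e0; split=> //.
  have := e0U => /eqP; rewrite (hcolor_coverP (sB e0 e0B)) => /imsetP[z zZ Ez].
  suff za : z = head H a by rewrite Ez za.
  (* Otherwise [z] and the head of [e0] would be two nodes of one color in a rainbow set. *)
  apply/eqP; apply: contraNT hZ => za.
  suff -> : head H e0 = z by [].
  have /card_le1_eqP := rain (f z); apply; rewrite !in_setI !in_setU.
    by rewrite in_setD1 za zZ orbT !inE eqxx (subsetP sZ).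
  rewrite -{1}hE; apply/andP; split; first by apply/orP; left; apply/covP; exists e0.
  by rewrite !inE -Ez eqxx (quotient_ends qH (sBH e0 e0B)).2.
rewrite inE => /andP[bB]; rewrite din1E ?sB // => /andP[_ /eqP hb].
exists a, b; split=> //; first by rewrite /hcolor hb /f' contract_color_cover.
by rewrite /hcolor hab.
Qed.

End CycleContraction.

(** * Reduced weights under dual steps *)

Lemma root_ends : proper_ends G.
Proof. by move=> e _; rewrite nodesG !inE. Qed.

(** A loop lies in no [din G [set v]] but may lie in [gamma G X], whence the case distinction in the
    [pi] term alone. *)
Lemma reduced_weightE pi xi e : reduced_weight G color w pi xi e =
  w e - (if tail G e == head G e then 0 else pi (color (head G e)))
  + \sum_X xi X * ((tail G e \in X) && (head G e \in X))%:R.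
Proof.
rewrite /reduced_weight; congr (_ - _ + _).
  have inner j : \sum_(v in color_class G color j) (e \in din G [set v])%:R =
      ((tail G e != head G e) && (color (head G e) == j))%:R :> R.
    rewrite (eq_bigr (fun v => if v == head G e then (tail G e != head G e)%:R else 0)).
      rewrite -big_mkcondr /=; case: (boolP (color (head G e) == j)) => cj.
        rewrite (big_pred1 (head G e)) ?andbT // => v; rewrite inE nodesG in_setT /=.
        by case: (v =P head G e) => [->|]; rewrite ?cj ?andbF.
      rewrite andbF big_pred0 // => v; rewrite inE nodesG in_setT /=.
      by case: (v =P head G e) => [->|]; rewrite ?(negPf cj) ?andbF.
    move=> v _; rewrite din1E ?arcsG ?in_setT // [head G e == v]eq_sym.
    by case: (v == head G e); rewrite ?andbT ?andbF.
  under eq_bigr do rewrite inner.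
  case: eqP => [_|_] /=; first by rewrite big1 // => j _; rewrite mulr0.
  rewrite (bigD1 (color (head G e))) //= eqxx mulr1 big1 ?addr0 // => j.
  by rewrite eq_sym => /negPf ->; rewrite mulr0.
apply: eq_big => [X|X _]; first by rewrite nodesG subsetT.
by rewrite inE arcsG in_setT.
Qed.

Section DualUpdate.
Variables (S : state R k V A) (c : ccolor) (eps : R) (Y : {set V}).
Hypotheses (qS : quotient (st_graph S) (st_color S)).
Hypothesis contracted_node : forall Q, Q \in st_contracted S -> Q \in nodes (st_graph S).
Hypothesis uncontracted_node : forall X, X \in nodes (st_graph S) ->
  X \notin st_contracted S -> exists v, X = [set v].
Hypotheses (YH : Y \in nodes (st_graph S)) (cY : st_color S Y = c).

Let w1 := st_weight G color w (dual_update S c eps).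
Let w0 := st_weight G color w S.

Lemma st_enteringP e : reflect [/\ e \in arcs (st_graph S),
  tail (st_graph S) e != head (st_graph S) e & hcolor (st_graph S) (st_color S) e = c]
  (e \in st_entering S c).
Proof. by apply: entering_colorP; exact: quotient_ends qS. Qed.

(** Contracted sets are nodes and hence disjoint, so for [e] only the [xi] term of the node [X]
    containing its head can change. The node [Y] certifies that [c] is a current color, determined
    by any original color in it. *)
Lemma dual_weightE X e : X \in nodes (st_graph S) -> head G e \in X ->
  w1 e = w0 e - eps * ((tail G e != head G e) && (st_color S X == c))%:R
    + eps * [&& X \in st_contracted S, st_color S X == c & tail G e \in X]%:R.
Proof.
move=> XH hX; rewrite /w1 /w0 /st_weight !reduced_weightE /=.
have -> : (color (head G e) \in c) = (st_color S X == c).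
  apply/idP/eqP => [hc|<-]; last exact: (color_in qS XH hX).
  by rewrite -cY; apply: (color_eq qS XH YH (color_in qS XH hX)); rewrite cY.
set b := st_color S X == c.
have -> : \sum_(X0 : {set V}) (if (X0 \in st_contracted S) && (st_color S X0 == c)
      then st_xi S X0 + eps else st_xi S X0) * ((tail G e \in X0) && (head G e \in X0))%:R =
    \sum_(X0 : {set V}) st_xi S X0 * ((tail G e \in X0) && (head G e \in X0))%:R +
    eps * [&& X \in st_contracted S, b & tail G e \in X]%:R.
  rewrite (bigD1 X) //= [X in _ = X + _](bigD1 X) //= hX andbT -/b.
  rewrite [in RHS]addrAC; congr (_ + _).
    by case: (X \in _); case: b; rewrite /= ?mulr0 ?addr0 // mulrDl.
  apply: eq_bigr => X1 neX; case: (boolP (X1 \in st_contracted S)) => //= X1c.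
  suff -> : head G e \in X1 = false by rewrite andbF !mulr0.
  by apply: contraNF neX => hX1; rewrite (node_eq qS (contracted_node X1c) XH hX1 hX).
by case: eqP => _; case: b => /=; lra.
Qed.

Lemma dual_weight_entering e : e \in st_entering S c -> w1 e = w0 e - eps.
Proof.
move=> /st_enteringP[eH nl hc].
have hX := head_in qS eH; have XH := (quotient_ends qS eH).2.
rewrite /hcolor in hc; rewrite (dual_weightE XH hX) hc eqxx andbT /=.
have -> : tail G e \in head (st_graph S) e = false.
  apply: contraNF nl => tX; apply/eqP.
  exact: (node_eq qS (quotient_ends qS eH).1 XH (tail_in qS eH) tX).
have -> : tail G e != head G e.
  apply: contraNneq nl => E; apply/eqP.
  by apply: (node_eq qS (quotient_ends qS eH).1 XH (tail_in qS eH)); rewrite E.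
by rewrite andbF mulr0 mulr1 addr0.
Qed.

(** If the head lies in a node of color [c] that [e] does not enter, the tail lies there too. As [e]
    is no loop, that node is a contracted set, and the changes of [pi] and [xi] cancel. *)
Lemma dual_weight_other e : e \notin st_entering S c -> tail G e != head G e -> w1 e = w0 e.
Proof.
move=> eN nl; have [X XH hX] := node_exists qS (head G e).
rewrite (dual_weightE XH hX) nl /=.
case cX: (st_color S X == c); last by rewrite andbF !mulr0; lra.
have tX : tail G e \in X.
  case: (boolP (e \in arcs (st_graph S))) => [eH|/(lost_arc qS)[X1 [X1H tX1 hX1]]]; last first.
    by rewrite (node_eq qS XH X1H hX hX1).
  have EX := node_eq qS XH (quotient_ends qS eH).2 hX (head_in qS eH).
  apply: contraNT eN => tX; apply/st_enteringP; split=> //.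
    by apply: contraNneq tX => E; rewrite EX -E; exact: (tail_in qS eH).
  by rewrite /hcolor -EX; apply/eqP.
have -> : X \in st_contracted S.
  apply: contraNT nl => /(uncontracted_node XH)[v E].
  by move: tX hX; rewrite E !inE => /eqP -> /eqP ->.
by rewrite tX /=; lra.
Qed.

(** For a loop the [pi] term is absent and the [xi] term can only grow. *)
Lemma dual_weight_ge e : 0 <= eps -> e \notin st_entering S c -> w0 e <= w1 e.
Proof.
move=> eps0 eN; case: (eqVneq (tail G e) (head G e)) => [E|nl]; last by rewrite dual_weight_other.
have [X XH hX] := node_exists qS (head G e).
rewrite (dual_weightE XH hX) E eqxx /= mulr0 subr0 lerDl.
by apply: mulr_ge0 => //; apply: ler0n.
Qed.

End DualUpdate.

(** Only the weights of arcs entering [c] decrease, each by [eps], so the largest feasible value is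
    their minimum. *)
Lemma feasible_epsP (S : state R k V A) c Y :
  quotient (st_graph S) (st_color S) ->
  (forall Q, Q \in st_contracted S -> Q \in nodes (st_graph S)) ->
  (forall X, X \in nodes (st_graph S) -> X \notin st_contracted S -> exists v, X = [set v]) ->
  Y \in nodes (st_graph S) -> st_color S Y = c ->
  (forall e, 0 <= st_weight G color w S e) ->
  (forall e, e \in st_entering S c -> 0 < st_weight G color w S e) ->
  st_entering S c != set0 ->
  exists2 e, e \in st_entering S c &
    feasible_eps G color w S c (st_weight G color w S e) /\
    forall eps, feasible_eps G color w S c eps -> eps <= st_weight G color w S e.
Proof.
move=> qS cN uN YH cY wS wc /set0Pn[e1 e1E].
case: (arg_minP (st_weight G color w S) e1E) => e eE emin.
exists e => //; split.
  split=> [|a _]; first exact: wc.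
  case: (boolP (a \in st_entering S c)) => aE.
    by rewrite (dual_weight_entering _ qS cN YH cY aE) subr_ge0; apply: emin.
  exact: le_trans (wS a) (dual_weight_ge qS cN uN YH cY (wS e) aE).
move=> eps [_ /(_ e)]; rewrite arcsG in_setT => /(_ isT).
by rewrite (dual_weight_entering _ qS cN YH cY eE) subr_ge0.
Qed.

(** * Weak duality and complementary slackness *)

Lemma forest_weight pi xi B : rainbow_forest G color B ->
  (forall j, exists2 e, e \in B & color (head G e) = j) ->
  \sum_(e in B) w e = \sum_(e in B) reduced_weight G color w pi xi e
    + \sum_j pi j - \sum_X xi X * #|B :&: gamma G X|%:R.
Proof.
move=> rfB cB.
have nl e : e \in B -> tail G e != head G e.
  exact: (sourced_neq root_ends (rf_arcs rfB) (rf_sourced rfB)).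
(* Every color is the head color of exactly one arc of [B]. *)
have -> : \sum_j pi j = \sum_(e in B) pi (color (head G e)).
  rewrite (partition_big (fun e => color (head G e)) xpredT) //=.
  apply: eq_bigr => j _; have [e eB ce] := cB j.
  rewrite (big_pred1 e) ?ce // => e' /=; apply/andP/eqP => [[e'B /eqP ce']|->].
    by apply: (rf_inj rfB e'B eB); rewrite /hcolor ce ce'.
  by rewrite eB ce eqxx.
have -> : \sum_X xi X * #|B :&: gamma G X|%:R =
    \sum_(e in B) \sum_X xi X * ((tail G e \in X) && (head G e \in X))%:R.
  rewrite exchange_big /=; apply: eq_bigr => X _; rewrite -mulr_sumr; congr (_ * _).
  rewrite -sum1_card natr_sum big_mkcond [RHS]big_mkcond /=; apply: eq_bigr => e _.
  by rewrite inE [e \in gamma _ _]inE arcsG in_setT /=; case: (e \in B) => //=; case: (_ && _).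
rewrite -big_split -sumrB /=; apply: eq_bigr => e eB.
by rewrite reduced_weightE (negPf (nl e eB)); lra.
Qed.

Lemma forest_gamma B X : rainbow_forest G color B -> (#|B :&: gamma G X| <= #|X|.-1)%N.
Proof.
move=> rfB; apply: sourced_gamma (rf_arcs rfB) _ (rf_sourced rfB) _; last by rewrite nodesG subsetT.
by move=> a b aB bB E; apply: (rf_inj rfB aB bB); rewrite /hcolor E.
Qed.

Lemma covers_colorP B : rainbow_forest G color B ->
  (forall j, covers G color B j) <-> (forall j, exists2 e, e \in B & color (head G e) = j).
Proof.
move=> rfB.
have nl : {in B, forall e, tail G e != head G e}.
  by move=> e; exact: (sourced_neq root_ends (rf_arcs rfB) (rf_sourced rfB)).
by split=> cB j; apply/(coversP _ _ root_ends (rf_arcs rfB) nl); exact: cB.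
Qed.

(* Weak duality: acyclicity bounds the number of arcs of any competitor inside X by
   |X| - 1, so that \sum_j pi j - \sum_X xi X * (|X| - 1) is a lower bound, and
   complementary slackness makes B attain it. *)
Lemma slackness_min pi xi B : rainbow_forest G color B ->
  (forall j, exists2 e, e \in B & color (head G e) = j) ->
  (forall e, 0 <= reduced_weight G color w pi xi e) ->
  (forall e, e \in B -> reduced_weight G color w pi xi e = 0) ->
  (forall X, 0 <= xi X) ->
  (forall X, xi X != 0 -> (#|X|.-1 <= #|B :&: gamma G X|)%N) ->
  min_covering_matroid_branching G color w B.
Proof.
move=> rfB cB w_ge0 wB xi_ge0 xiB; split.
  split; first exact: forest_matroid_branching root_ends rfB.
  by apply/(covers_colorP rfB).
move=> B' [mB' cB']; have rfB' := matroid_branching_forest root_ends mB'.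
have {}cB' := (covers_colorP rfB').1 cB'.
rewrite (forest_weight pi xi rfB cB) (forest_weight pi xi rfB' cB').
apply: lerD; last first.
  rewrite lerN2; apply: ler_sum => X _; case: (eqVneq (xi X) 0) => [->|nz].
    by rewrite !mul0r.
  rewrite ler_wpM2l // ler_nat; apply: leq_trans (xiB X nz); exact: forest_gamma.
by rewrite lerD2r big1 // sumr_ge0.
Qed.

Lemma forest_uncontracted B :
  rainbow_forest (uncontracted G) (uncontracted_color color) B -> rainbow_forest G color B.
Proof.
move=> [sB iB srcB]; split=> //.
  move=> a b aB bB; rewrite /hcolor => E; apply: iB => //.
  by rewrite /hcolor /= /uncontracted_color !imset_set1 E.
move=> X sX /set0Pn[x xX].
have [||v] := srcB [set [set v] | v in X].
- by apply/subsetP => _ /imsetP[v vX ->]; apply: imset_f; rewrite nodesG inE.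
- by apply/set0Pn; exists [set x]; apply: imset_f.
move=> /imsetP[u uX ->] src; exists u => // e eB hu.
by apply: contra (src e eB _) => [tX|]; [apply: imset_f | rewrite /= hu].
Qed.

Lemma covers_uncontracted B :
  covers_nodes (uncontracted G) (uncontracted_color color) B ->
  forall j, exists2 e, e \in B & color (head G e) = j.
Proof.
move=> cB j; have [v _ cv] := color_surj j.
have [|e eB] := cB [set v]; first by apply: imset_f; rewrite nodesG inE.
rewrite /hcolor /= /uncontracted_color !imset_set1 cv => /set1_inj E.
by exists e.
Qed.

(** [Q] consists of heads of arcs of [B] inside it and of at most one more node, the exceptional
    one. *)
Lemma spanned_uncontracted B Q : spanned (uncontracted G) B Q ->
  (#|Q|.-1 <= #|B :&: gamma G Q|)%N.
Proof.
move=> [_ [X0 span]].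
pose E := [set x : V | [set x] == X0].
have cE : (#|E| <= 1)%N.
  apply/card_le1_eqP => x y; rewrite !inE => /eqP Ex /eqP Ey.
  by apply: set1_inj; rewrite Ex Ey.
have sQ : Q \subset E :|: [set head G e | e in B :&: gamma G Q].
  apply/subsetP => v vQ; rewrite in_setU inE; case: eqP => //= neX.
  have [||e [eB [hv] tQ]] := span [set v] _ _ (introN eqP neX).
  - by apply: imset_f; rewrite nodesG inE.
  - by rewrite sub1set.
  move: hv => /= /set1_inj hv; move: tQ => /=; rewrite sub1set => tQ.
  by apply/imsetP; exists e => //; rewrite !inE eB arcsG in_setT tQ hv.
have le1 : (#|Q| <= #|E| + #|[set head G e | e in B :&: gamma G Q]|)%N.
  by apply: leq_trans (subset_leq_card sQ) _; rewrite cardsU leq_subr.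
rewrite -subn1 leq_subLR (leq_trans le1) // leq_add //; exact: leq_imset_card.
Qed.

(** * Invariants of the two phases *)

Local Notation history := (history R k V A).
Local Notation state := (state R k V A).
Implicit Types (h : history) (S : state).

(* G^i and its coloring, recomputed from the labels of the past steps. *)
Fixpoint level h : cdigraph * ({set V} -> ccolor) :=
  match h with
  | [::] => (uncontracted G, uncontracted_color color)
  | (_, None) :: h' => level h'
  | (_, Some K) :: h' =>
      let Z := cycle_nodes (level h').1 K in
      (contract (level h').1 Z, contract_color (level h').2 Z)
  end.

Fixpoint history_ok h : Prop :=
  match h with
  | [::] => True
  | (T, l) :: h' => [/\ history_ok h', st_graph T = (level h').1,
      st_color T = (level h').2 &
      if l is Some K then rainbow_cycle (level h').1 (level h').2 K else True]
  end.

Fixpoint history_arcs h : {set A} :=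
  match h with
  | [::] => set0
  | (_, None) :: h' => history_arcs h'
  | (_, Some K) :: h' => K :|: history_arcs h'
  end.

Fixpoint history_sets h : {set {set V}} :=
  match h with
  | [::] => set0
  | (_, None) :: h' => history_sets h'
  | (_, Some K) :: h' => cover (cycle_nodes (level h').1 K) |: history_sets h'
  end.

Lemma quotient_level h : history_ok h -> quotient (level h).1 (level h).2.
Proof.
elim: h => [_|[S [K|]] h IHh] /=; first exact: quotient_uncontracted.
  by case=> /IHh qh _ _ rcK; exact: (quotient_contract_cycle qh rcK).
by case=> /IHh.
Qed.

(** This keeps contracted cycles tight: an arc gone from the current graph enters no current color,
    and a dual step leaves such an arc unchanged unless it is a loop. *)
Lemma history_arc_lost h e : history_ok h -> e \in history_arcs h ->
  e \notin arcs (level h).1 /\ tail G e != head G e.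
Proof.
elim: h => [|[S [K|]] h IHh] /=; [by rewrite inE| |by case=> /IHh].
case=> hok _ _ rcK; have qh := quotient_level hok; rewrite inE => /orP[eK|/(IHh hok)[eN nl]].
  split; first exact: (cycle_arc_lost rcK eK).
  have eH := subsetP (dcycle_arcs (rc_cycle rcK)) e eK.
  apply: contraNneq (rc_neq rcK eK) => E; apply/eqP.
  have [tH hH] := quotient_ends qh eH.
  by apply: (node_eq qh tH hH (tail_in qh eH)); rewrite E; exact: (head_in qh eH).
split=> //; apply: contra eN; apply: (subsetP (contract_arcs _ _)).
Qed.

(** [ci_tight] includes the arcs of contracted cycles because restoration returns all but one of
    each cycle to the branching. *)
Record contracting_inv h S : Prop := ContractingInv {
  ci_history : history_ok h;
  ci_graph : st_graph S = (level h).1;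
  ci_color : st_color S = (level h).2;
  ci_forest : rainbow_forest (st_graph S) (st_color S) (st_branching S);
  ci_ge0 : forall e, 0 <= st_weight G color w S e;
  ci_tight : forall e, e \in st_branching S :|: history_arcs h -> st_weight G color w S e = 0;
  ci_xi_ge0 : forall X, 0 <= st_xi S X;
  ci_xi : forall X, st_xi S X != 0 -> X \in history_sets h;
  ci_contracted : forall Q, Q \in st_contracted S ->
    Q \in nodes (st_graph S) /\ Q \in history_sets h;
  ci_uncontracted : forall X, X \in nodes (st_graph S) -> X \notin st_contracted S ->
    exists v, X = [set v] }.

(** [Restoring] stores no current dual values, hence the existential. A set with [xi X != 0] either
    belongs to a contraction still to be undone or is already spanned. *)
Definition restoring_inv h B : Prop := exists pi xi,
  [/\ history_ok h, rainbow_forest (level h).1 (level h).2 B,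
      covers_nodes (level h).1 (level h).2 B &
  [/\ forall e, 0 <= reduced_weight G color w pi xi e,
      forall e, e \in B :|: history_arcs h -> reduced_weight G color w pi xi e = 0,
      forall X, 0 <= xi X &
      forall X, xi X != 0 -> X \in history_sets h \/ spanned (level h).1 B X]].

Lemma ci_quotient h S : contracting_inv h S -> quotient (st_graph S) (st_color S).
Proof.
move=> ci; rewrite (ci_graph ci) (ci_color ci).
by apply: quotient_level; exact: (ci_history ci).
Qed.

Lemma ci_neq h S : contracting_inv h S ->
  {in st_branching S, forall e, tail (st_graph S) e != head (st_graph S) e}.
Proof.
move=> ci e; exact: (sourced_neq (quotient_ends (ci_quotient ci)) (rf_arcs (ci_forest ci))
  (rf_sourced (ci_forest ci))).
Qed.

Lemma st_coversP h S c : contracting_inv h S ->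
  reflect (exists2 e, e \in st_branching S & hcolor (st_graph S) (st_color S) e = c)
    (covered (st_graph S) (st_branching S) :&: color_class (st_graph S) (st_color S) c != set0).
Proof.
move=> ci.
exact: (coversP _ _ (quotient_ends (ci_quotient ci)) (rf_arcs (ci_forest ci)) (ci_neq ci)).
Qed.

Lemma selectable_node h S c : contracting_inv h S -> selectable S c ->
  [/\ {in st_branching S, forall b, hcolor (st_graph S) (st_color S) b != c},
      st_entering S c != set0 &
      exists2 Y, Y \in nodes (st_graph S) & st_color S Y = c].
Proof.
move=> ci [ncov cE]; have qS := ci_quotient ci; split=> //.
  move=> b bB; apply/eqP => E; apply: ncov; apply/(st_coversP _ ci).
  by exists b.
have /set0Pn[e /(st_enteringP _ qS)[eH _ hc]] := cE.
by exists (head (st_graph S) e); [exact: (quotient_ends qS eH).2 | exact: hc].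
Qed.

Lemma contracting_initial pi0 :
  (forall a, a \in arcs G -> 0 <= reduced_weight G color w pi0 (fun=> 0) a) ->
  contracting_inv [::] (initial_state G color pi0).
Proof.
move=> w_ge0; split=> //=.
- split; first by apply: sub0set.
    by move=> a b; rewrite inE.
  by move=> X _ /set0Pn[v vX]; exists v => // e; rewrite inE.
- by move=> e; apply: w_ge0; rewrite arcsG inE.
- by move=> e; rewrite !inE.
- by move=> X; rewrite eqxx.
- by move=> Q; rewrite inE.
- by move=> X /imsetP[v _ ->] _; exists v.
Qed.

Lemma contracting_dual h S c eps : contracting_inv h S -> selectable S c ->
  feasible_eps G color w S c eps ->
  contracting_inv ((S, None) :: h) (dual_update S c eps).
Proof.
move=> ci sel [eps_gt0 feas]; have qS := ci_quotient ci.
have [ncov _ [Y YH cY]] := selectable_node ci sel.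
have cN Q (Qc : Q \in st_contracted S) : Q \in nodes (st_graph S) := (ci_contracted ci Qc).1.
split=> /=; try by case: ci.
- by move=> e; apply: feas; rewrite arcsG inE.
- move=> e eT; rewrite (dual_weight_other eps qS cN (ci_uncontracted ci) YH cY).
  + exact: (ci_tight ci eT).
  + apply/(st_enteringP _ qS) => -[eH nl hc]; move: eT; rewrite inE => /orP[eB|].
      by case/eqP: (ncov e eB).
    by move/(history_arc_lost (ci_history ci)) => []; rewrite -(ci_graph ci) eH.
  + move: eT; rewrite inE => /orP[eB|/(history_arc_lost (ci_history ci))[]//].
    have eH := subsetP (rf_arcs (ci_forest ci)) e eB.
    apply: contraNneq (ci_neq ci eB) => E; apply/eqP.
    have [tH hH] := quotient_ends qS eH.
    by apply: (node_eq qS tH hH (tail_in qS eH)); rewrite E; exact: (head_in qS eH).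
- move=> X; case: ifP => _; last exact: (ci_xi_ge0 ci X).
  by apply: addr_ge0; [exact: (ci_xi_ge0 ci X) | exact: ltW].
- move=> X; case: ifP => [/andP[/(ci_contracted ci)[_ Xh] _] _ //|_]; exact: (ci_xi ci).
Qed.

Section PrimalStep.
Variables (h : history) (S : state) (c : ccolor) (a : A).
Hypotheses (ci : contracting_inv h S) (sel : selectable S c) (ac : a \in st_entering S c).
Hypothesis w_a : st_weight G color w S a = 0.
Let H := st_graph S.
Let B := st_branching S.
Let f := st_color S.

Lemma primal_arc : [/\ a \in arcs H, tail H a != head H a & hcolor H f a = c].
Proof. exact/(st_enteringP _ (ci_quotient ci)). Qed.

Lemma primal_uncovered : {in B, forall b, hcolor H f b != hcolor H f a}.
Proof.
by have [_ _ ->] := primal_arc; have [] := selectable_node ci sel.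
Qed.

Lemma primal_arcs : a |: B \subset arcs H.
Proof.
have [aH _ _] := primal_arc.
apply/subsetP => e; rewrite !inE => /orP[/eqP -> //|].
exact: (subsetP (rf_arcs (ci_forest ci))).
Qed.

Lemma primal_inj : {in a |: B &, injective (hcolor H f)}.
Proof.
move=> d e; rewrite !inE => /orP[/eqP ->|dB] /orP[/eqP ->|eB] E //.
- by case/eqP: (primal_uncovered eB).
- by case/eqP: (primal_uncovered dB).
- exact: (rf_inj (ci_forest ci) dB eB E).
Qed.

Lemma primal_tight e : e \in a |: B -> st_weight G color w S e = 0.
Proof.
rewrite !inE => /orP[/eqP -> //|eB]; apply: (ci_tight ci).
by rewrite inE eB.
Qed.

Lemma contracting_add : (forall K, directed_cycle H K -> ~~ (K \subset a |: B)) ->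
  contracting_inv ((S, None) :: h) (add_update S a).
Proof.
move=> nocyc; split=> /=; try by case: ci.
  split; [exact: primal_arcs | exact: primal_inj |].
  have [//|[K dcK sK]] := dcycle_or_sourced primal_arcs.
  by case/negP: (nocyc K dcK).
move=> e; rewrite -setUA in_setU => /orP[ea|eT]; last exact: (ci_tight ci eT).
by apply: primal_tight; rewrite in_setU ea.
Qed.

Lemma primal_cycle K : directed_cycle H K -> K \subset a |: B -> rainbow_cycle H f K.
Proof.
move=> dcK /subsetP sK; split=> //.
  by move=> d e /sK dB /sK eB; apply: primal_inj.
move=> e /sK; rewrite !inE => /orP[/eqP ->|]; first by case: primal_arc.
exact: (ci_neq ci).
Qed.

Lemma contracting_contract K : directed_cycle H K -> K \subset a |: B ->
  contracting_inv ((S, Some K) :: h) (contract_update S (cycle_nodes H K)).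
Proof.
move=> dcK sK; have rcK := primal_cycle dcK sK.
have qS := ci_quotient ci.
have hist : history_ok ((S, Some K) :: h).
  split; rewrite -?(ci_graph ci) -?(ci_color ci) //; exact: (ci_history ci).
split; rewrite //= -?(ci_graph ci) -?(ci_color ci) //.
- exact: (forest_contract qS rcK (ci_forest ci) primal_uncovered sK).
- exact: (ci_ge0 ci).
- move=> e; rewrite in_setU => /orP[|].
    by rewrite in_setD => /andP[_ eB]; apply: primal_tight; rewrite !inE eB orbT.
  rewrite in_setU => /orP[/(subsetP sK)|eh]; first exact: primal_tight.
  by apply: (ci_tight ci); rewrite in_setU eh orbT.
- exact: (ci_xi_ge0 ci).
- by move=> X /(ci_xi ci) Xh; rewrite in_setU Xh orbT.
- move=> Q; rewrite in_setU1 => /orP[/eqP ->|]; first by rewrite !inE eqxx.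
  rewrite in_setD => /andP[QZ /(ci_contracted ci)[QH Qh]].
  by rewrite in_setU1 [Q \in _ :\: _]in_setD QZ QH in_setU1 Qh !orbT.
- move=> X; rewrite in_setU1 => /orP[/eqP ->|]; first by rewrite !inE eqxx.
  rewrite in_setD => /andP[XZ XH]; rewrite in_setU1 in_setD XZ negb_or /= => /andP[_].
  exact: (ci_uncontracted ci).
Qed.

End PrimalStep.

Lemma contracting_step h S l S' : contracting_inv h S ->
  contraction_step G color w S l S' -> contracting_inv ((S, l) :: h) S'.
Proof.
move=> ci; case=> [c eps sel _ feas _|c a sel ac wa nocyc|c a K sel ac wa dcK sK].
- exact: (contracting_dual ci sel feas).
- exact: (contracting_add ci sel ac wa nocyc).
- exact: (contracting_contract ci sel ac wa dcK sK).
Qed.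

Lemma contracting_stop h S : contracting_inv h S -> stopping S ->
  restoring_inv h (st_branching S).
Proof.
move=> ci stop; exists (st_pi S), (st_xi S).
have qS := ci_quotient ci.
rewrite -(ci_graph ci) -(ci_color ci); split.
- exact: (ci_history ci).
- exact: (ci_forest ci).
- move=> X XH; apply/(st_coversP _ ci); apply: stop.
  have [v vX] := node_inhabited qS XH.
  (* [X] may be [[set s]], which no arc enters, so a node [u] other than [s] of the same color
     serves. Its arc from [s] is not lost, because [s] remains a node of its own. *)
  have [u us cu] := color_surj (color v).
  have [e te he] := root_arc us.
  have [Y YH uY] := node_exists qS u.
  have sN : s \notin Y.
    apply: contraNN us => sY.
    have := node_eq qS YH (root_node qS) sY; rewrite inE eqxx => /(_ isT) EY.
    by move: uY; rewrite EY inE.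
  have fY : st_color S Y = st_color S X.
    apply: (color_eq qS YH XH (color_in qS YH uY)).
    by rewrite cu; exact: (color_in qS XH vX).
  have eH : e \in arcs (st_graph S).
    apply: contraNT sN => /(lost_arc qS)[Z [ZH tZ hZ]].
    by rewrite he in hZ; rewrite (node_eq qS YH ZH uY hZ) -te.
  have hY : head (st_graph S) e = Y.
    apply: (node_eq qS (quotient_ends qS eH).2 YH (head_in qS eH)).
    by rewrite he.
  apply/set0Pn; exists e; apply/(st_enteringP _ qS); split=> //.
    by rewrite hY; apply: contraNneq sN => <-; rewrite -te; exact: (tail_in qS eH).
  by rewrite /hcolor hY.
split.
- exact: (ci_ge0 ci).
- exact: (ci_tight ci).
- exact: (ci_xi_ge0 ci).
- by move=> X /(ci_xi ci); left.
Qed.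

Lemma restoring_step S l h B B1 : restoring_inv ((S, l) :: h) B ->
  restoration_step S B l B1 -> restoring_inv h B1.
Proof.
case: l => [K|]; last first.
  move=> inv st; move EN : None st => l st.
  suff -> : B1 = B by case: inv => pi [xi [[hok _ _ _] ? ? ?]]; exists pi, xi.
  by case: st EN.
case=> pi [xi [/= [hok ES Ef rcK] rfB cB [w_ge0 wB xi_ge0 xiB]]] st.
have qh := quotient_level hok.
have [a [e0 [aK e0B e0U e0a ->]]] := restoration_arc qh rcK ES Ef rfB cB st.
exists pi, xi; split=> //.
- exact: (forest_restore qh rcK rfB aK e0B e0U e0a).
- by move=> X; exact: (covers_restore qh rcK rfB e0B e0a cB).
split=> //.
- move=> e He; apply: wB; move: He; rewrite !in_setU in_setD1.
  by case: (e \in B); case: (e \in K); case: (e \in history_arcs h); rewrite ?orbT ?andbF.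
- move=> X /xiB; rewrite in_setU1 => -[/orP[/eqP ->|Xh]|sX]; [right|left|right] => //.
    exact: (spanned_cover qh rcK).
  exact: (spanned_restore qh rcK rfB e0B e0U e0a sX).
Qed.

Lemma restoring_progress S l h B : restoring_inv ((S, l) :: h) B ->
  exists B1, restoration_step S B l B1.
Proof.
case: l => [K|]; last by exists B; constructor.
case=> pi [xi [/= [hok ES Ef rcK] rfB cB _]].
have qh := quotient_level hok.
have := RestoreUncovered (S := S) (B := B) (K := K).
have := RestoreCovered (S := S) (B := B) (K := K).
rewrite /= ES Ef => cov unc.
set Z := cycle_nodes _ K in cov unc.
case: (eqVneq (B :&: din (contract (level h).1 Z) [set cover Z]) set0) => [nB|/set0Pn[b bB]].
  have [a aK rain] := uncovered_restorable qh rcK rfB cB nB.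
  by exists (B :|: (K :\ a)); apply: (unc (head (level h).1 a) a nB) => //; apply: dcycle_head.
have bH : b \in arcs (contract (level h).1 Z).
  by move: bB; rewrite in_setI [b \in din _ _]inE => /andP[_ /andP[]].
have : head (level h).1 b \in Z.
  move: bB; rewrite in_setI din1E // (contract_head bH) => /andP[_ /andP[_]].
  case: ifPn => // bN; have sZ := cycle_nodes_sub qh rcK.
  have bH1 := subsetP (contract_arcs _ _) b bH.
  by rewrite (negPf (neq_cover qh sZ (quotient_ends qh bH1).2 bN)).
case/imsetP => a aK hab; exists (B :|: (K :\ a)).
exact: (cov _ _ bB aK (esym hab)).
Qed.

Lemma contracting_progress h S : contracting_inv h S ->
  stopping S \/ exists l S', contraction_step G color w S l S'.
Proof.
move=> ci; have qS := ci_quotient ci.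
case: (classic (stopping S)) => [|nstop]; [by left|right].
have [c sel] : exists c, selectable S c.
  apply: NNPP => none; apply: nstop => c cE; apply: NNPP => ncov.
  by apply: none; exists c.
have [ncov cE [Y YH cY]] := selectable_node ci sel.
case: (boolP [exists a in st_entering S c, st_weight G color w S a == 0]).
  move=> /exists_inP[a ac /eqP wa].
  case: (classic (exists2 K, directed_cycle (st_graph S) K & K \subset a |: st_branching S)).
    move=> [K dcK sK]; exists (Some K), (contract_update S (cycle_nodes (st_graph S) K)).
    exact: (PrimalContract sel ac wa dcK sK).
  move=> nocyc; exists None, (add_update S a); apply: PrimalAdd sel ac wa _.
  by move=> K dcK; apply/negP => sK; apply: nocyc; exists K.
rewrite negb_exists => /forallP notight.
have wc e : e \in st_entering S c -> 0 < st_weight G color w S e.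
  by move=> ec; have := notight e; rewrite ec /= lt_def => ->; exact: (ci_ge0 ci e).
have cN Q (Qc : Q \in st_contracted S) : Q \in nodes (st_graph S) := (ci_contracted ci Qc).1.
have [e ec [feas emax]] :=
  feasible_epsP qS cN (ci_uncontracted ci) YH cY (ci_ge0 ci) wc cE.
exists None, (dual_update S c (st_weight G color w S e)).
exact: (DualStep sel wc feas emax).
Qed.

(** * Termination of the contraction phase *)

Definition uncovered_nodes S : {set {set V}} :=
  [set X in nodes (st_graph S) | [forall b in st_branching S,
     hcolor (st_graph S) (st_color S) b != st_color S X]].

Definition untight_nodes S : {set {set V}} :=
  [set X in nodes (st_graph S) | [forall e in st_entering S (st_color S X),
     st_weight G color w S e != 0]].

(** Nodes are named by elements of [{set V}], so [base] exceeds each of the counts below. *)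
Let base := #|{set V}|.+1.

(* Lexicographic: a contraction decreases the number of nodes, an added arc the number of
   uncovered nodes, and a dual step the number of nodes of a color without tight arcs. *)
Definition potential S : nat :=
  ((#|nodes (st_graph S)| * base + #|uncovered_nodes S|) * base + #|untight_nodes S|)%N.

Lemma ltn_lex (x y t u : nat) : (t < base)%N -> (x < y)%N -> (x * base + t < y * base + u)%N.
Proof.
move=> lt lxy; apply: leq_trans (leq_addr _ _); apply: leq_trans (leq_mul lxy (leqnn base)).
by rewrite mulSn addnC ltn_add2r.
Qed.

Lemma ltn_base (E : {set {set V}}) : (#|E| < base)%N.
Proof. exact: max_card. Qed.

Lemma potential_dual h S c eps : contracting_inv h S -> selectable S c ->
  (forall a, a \in st_entering S c -> 0 < st_weight G color w S a) ->
  feasible_eps G color w S c eps ->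
  (forall eps', feasible_eps G color w S c eps' -> eps' <= eps) ->
  (potential (dual_update S c eps) < potential S)%N.
Proof.
move=> ci sel wc feas emax; have qS := ci_quotient ci.
have [ncov cE [Y YH cY]] := selectable_node ci sel.
have cN Q (Qc : Q \in st_contracted S) : Q \in nodes (st_graph S) := (ci_contracted ci Qc).1.
rewrite /potential ltn_add2l; apply: proper_card; apply/properP; split.
  (* A tight arc that enters a current color does not enter [c], so it stays tight. *)
  apply/subsetP => X; rewrite !inE => /andP[XH /forall_inP tX]; rewrite XH /=.
  apply/forall_inP => e eX; apply: contra (tX e eX) => /eqP we.
  have [eH nl hX] := st_enteringP _ qS _ eX.
  rewrite (dual_weight_other eps qS cN (ci_uncontracted ci) YH cY) ?we //.
    by apply/negP => /wc; rewrite we ltxx.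
  apply: contraNneq nl => E; apply/eqP.
  have [tH hH] := quotient_ends qS eH.
  by apply: (node_eq qS tH hH (tail_in qS eH)); rewrite E; exact: (head_in qS eH).
(* By maximality [eps] is the smallest weight of an arc entering [c], so such an arc becomes
   tight. *)
have [e ec [feas0 emin]] :=
  feasible_epsP qS cN (ci_uncontracted ci) YH cY (ci_ge0 ci) wc cE.
have Eeps : eps = st_weight G color w S e.
  by apply/le_anti; rewrite (emin _ feas) (emax _ feas0).
exists Y; rewrite !inE YH //= ?cY; first by apply/forall_inP => a /wc; rewrite lt0r => /andP[].
rewrite negb_forall; apply/existsP; exists e; rewrite negb_imply ec /= negbK.
by rewrite (dual_weight_entering eps qS cN YH cY ec) Eeps subrr.
Qed.

Lemma potential_step h S l S' : contracting_inv h S ->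
  contraction_step G color w S l S' -> (potential S' < potential S)%N.
Proof.
move=> ci; case=> [c eps sel wc feas emax|c a sel ac wa nocyc|c a K sel ac wa dcK sK].
- exact: (potential_dual ci sel wc feas emax).
- apply: ltn_lex; rewrite ?ltn_base // ltn_add2l.
  have [aH nl hc] := primal_arc ci ac; have [_ hH] := quotient_ends (ci_quotient ci) aH.
  apply: proper_card; apply/properP; split.
    apply/subsetP => X; rewrite !inE => /andP[-> /forall_inP unc] /=.
    by apply/forall_inP => b bB; apply: unc; rewrite !inE bB orbT.
  exists (head (st_graph S) a); rewrite !inE hH /=.
    by apply/forall_inP => b; exact: (primal_uncovered ci sel ac).
  by apply/negP => /forall_inP/(_ a); rewrite !inE !eqxx => /(_ isT).
- have rcK := primal_cycle ci sel ac dcK sK; have qS := ci_quotient ci.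
  apply: ltn_lex; rewrite ?ltn_base //; apply: ltn_lex; rewrite ?ltn_base //.
  exact: (card_contract (cycle_nodes_sub qS rcK) (cycle_nodes_gt1 rcK)).
Qed.

(** * Executions: invariant, measure and progress *)

Definition config_inv (c : config R k V A) : Prop :=
  match c with
  | Contracting h T => contracting_inv h T
  | Restoring h B => restoring_inv h B
  end.

(** A contraction-phase step lengthens the history by one, which the drop of the doubled potential
    outweighs; the extra one pays for stopping, and the history length counts the restoration steps
    left. *)
Definition config_measure (c : config R k V A) : nat :=
  match c with
  | Contracting h T => (size h + (potential T).*2.+1)%N
  | Restoring h _ => size h
  end.

Lemma config_inv_step c c' : config_inv c -> step G color w c c' ->
  config_inv c' /\ (config_measure c' < config_measure c)%N.
Proof.
move=> inv st; case: st inv => [h T l T' st|h T stop|T l h B B1 st] /= inv.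
- split; first exact: (contracting_step inv st).
  by have := potential_step inv st; lia.
- by split; [exact: (contracting_stop inv stop) | lia].
- by split; first exact: (restoring_step inv st).
Qed.

Lemma config_inv_initial c : initial G color w c -> config_inv c.
Proof. by case=> pi0 /contracting_initial. Qed.

Lemma config_inv_reachable c : reachable G color w c -> config_inv c.
Proof.
elim=> [c0 /config_inv_initial //|c0 c1 _ inv st].
by have [] := config_inv_step inv st.
Qed.

Lemma config_progress c : config_inv c ->
  (exists B, c = output R k V B) \/ exists c', step G color w c c'.
Proof.
case: c => [h T|[|[T l] h] B] /= inv.
- right; have [stop|[l [S' st]]] := contracting_progress inv.
    by exists (Restoring h (st_branching T)); constructor.
  by exists (Contracting ((T, l) :: h) S'); constructor.
- by left; exists B.
- by right; have [B1 st] := restoring_progress inv; exists (Restoring h B1); constructor.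
Qed.

Lemma restored_optimal B : restoring_inv [::] B -> min_covering_matroid_branching G color w B.
Proof.
case=> pi [xi [_ rfB cB [w_ge0 wB xi_ge0 xiB]]].
apply: (slackness_min (forest_uncontracted rfB) (covers_uncontracted cB) w_ge0 _ xi_ge0).
  by move=> e eB; apply: wB; rewrite inE eB.
by move=> X /xiB[|/spanned_uncontracted //]; rewrite inE.
Qed.

Lemma algorithm_correct_root : algorithm_correct G color w.
Proof.
split.
- move=> [r [r0 st]].
  have inv i : config_inv (r i).
    elim: i => [|i IHi]; first exact: config_inv_initial.
    by have [] := config_inv_step IHi (st i).
  have bound i : (config_measure (r i) + i <= config_measure (r 0%N))%N.
    elim: i => [|i IHi]; first by rewrite addn0.
    by have [_] := config_inv_step (inv i) (st i); lia.
  by have := bound (config_measure (r 0%N)).+1; lia.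
- by move=> c /config_inv_reachable/config_progress.
- by move=> B /config_inv_reachable/restored_optimal.
Qed.

End Algorithm.

(** * Existence of a start, and the augmented digraph as an instance *)

Lemma initial_exists (R : realFieldType) (k : nat) (V A : finType) (G : digraph V A)
    (color : V -> 'I_k) (w : A -> R) : nodes G = setT -> arcs G = setT ->
  (forall e, tail G e = head G e -> 0 <= w e) -> exists c, initial G color w c.
Proof.
move=> nodesG arcsG w_loop.
(* This [pi] raises the weight of each non-loop arc by at least its absolute value; loops are beyond
   its reach and rely on [w_loop]. *)
exists (Contracting [::] (initial_state G color (fun=> - \sum_a `|w a|))).
constructor=> e _; rewrite reduced_weightE // [X in _ + X]big1 ?addr0;
  last by move=> X _; rewrite mul0r.
case: eqP => [/w_loop|_]; first by rewrite subr0.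
have : `|w e| <= \sum_a `|w a| by rewrite (bigD1 e) //= lerDl sumr_ge0.
by rewrite ler_norml opprK => /andP[+ _]; rewrite lerNl -subr_ge0 opprK addrC.
Qed.

Theorem theorem3 (R : realFieldType) (k : nat) (V0 A0 : finType)
    (tail0 head0 : A0 -> V0) (color0 : V0 -> 'I_k) (cs : 'I_k)
    (w0 : A0 -> R) (M : R)
    (V0_nonempty : (0 < #|V0|)%N)
    (color0_nonempty : forall j : 'I_k, exists v : V0, color0 v = j)
    (M_gt0 : 0 < M)
    (M_gt_w0 : forall a : A0, w0 a < M) :
  let G := augmented tail0 head0 in
  let color := augmented_color color0 cs in
  let w := augmented_weight w0 M in
  ((forall a : A0, tail0 a = head0 a -> 0 <= w0 a) ->
     exists c, initial G color w c) /\
  algorithm_correct G color w.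
Proof.
move=> G color w; split=> [w0_loop|].
  by apply: initial_exists => // -[a [/w0_loop]|v].
apply: (@algorithm_correct_root _ _ _ _ G color w None) => //.
- by case.
- by case=> // v _; exists (inr v).
- by move=> j; have [v cv] := color0_nonempty j; exists (Some v).
Qed.
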